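(* Let $b>1$ be an integer, let $A\subset\{0,1,\dots,b-1\}$ contain at least one non-zero element, let $N=\#A$ and $s_0=\log_bN$. For $m\in\mathbb{N}=\{0,1,2,\dots\}$ and $k\in\mathbb{Z}$ put $s_{m,k}=s_0-m+k\frac{2\pi i}{\log b}$. Then the meromorphic continuation to $\mathbb{C}$ of the restricted Dirichlet series $K(s)$ has a pole at $s_{m,k}$ if and only if both $s_{m,0}$ and $s_{0,k}$ are poles of it.
   Context: An integer $n>0$ is admissible if all digits of its (minimal) base-$b$ representation belong to $A$. $K(s)=\sum'n^{-s}$ (sum over admissible $n>0$) converges for $\Re s>s_0$ and extends to a meromorphic function on $\mathbb{C}$, with at most simple poles, located among the points $s_{m,k}$. *)

(* Defs.v *)
From Stdlib Require Import Reals List ZArith ClassicalEpsilon.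
From Coquelicot Require Import Coquelicot.

Open Scope R_scope.

(** * Complex exponential and powers *)

Definition Cexp (z : C) : C :=
  (exp (Re z) * cos (Im z), exp (Re z) * sin (Im z)).

(** [x ^ s = exp (s log x)], meaningful for [0 < x]. *)
Definition Rpow_C (x : R) (s : C) : C := Cexp (s * RtoC (ln x))%C.

(** * Meromorphic functions on the complex plane *)

Definition analytic_at (f : C -> C) (z0 : C) : Prop :=
  exists (a : nat -> C) (r : R), 0 < r /\
    forall z : C, Cmod (z - z0)%C < r ->
      @is_pseries C_AbsRing C_NormedModule a (z - z0)%C (f z).

(** The condition is on a punctured neighbourhood: since [f] is a total
    function, it has a value at [z0], which plays no role. *)
Definition pole_of_order (f : C -> C) (z0 : C) (p : nat) : Prop :=
  (0 < p)%nat /\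
  exists (g : C -> C) (r : R),
    analytic_at g z0 /\ g z0 <> RtoC 0 /\ 0 < r /\
    forall z : C, 0 < Cmod (z - z0)%C < r ->
      f z = (g z / (z - z0) ^ p)%C.

Definition pole (f : C -> C) (z0 : C) : Prop :=
  exists p : nat, pole_of_order f z0 p.

(** Poles are automatically isolated, by [pole_of_order]. *)
Definition meromorphic (f : C -> C) : Prop :=
  forall z0 : C, analytic_at f z0 \/ pole f z0.

(** * Integers with restricted digits *)

Definition digit (b n i : nat) : nat := ((n / b ^ i) mod b)%nat.

(** For [1 < b] and [0 < n], the positions occurring in the minimal base-[b]
    representation of [n] (no leading zero) are the [i] with [b ^ i <= n]. *)
Definition admissible (b : nat) (A : list nat) (n : nat) : Prop :=
  (0 < n)%nat /\ forall i : nat, (b ^ i <= n)%nat -> In (digit b n i) A.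

Definition restricted_term (b : nat) (A : list nat) (s : C) (n : nat) : C :=
  if excluded_middle_informative (admissible b A n)
  then Rpow_C (INR n) (- s)%C
  else RtoC 0.

(** [A] is duplicate-free in the intended use, so that [length A] is its
    cardinality. *)
Definition abscissa (b : nat) (A : list nat) : R :=
  ln (INR (length A)) / ln (INR b).

(** Includes the convergence of the series on the half-plane. *)
Definition is_meromorphic_continuation
    (b : nat) (A : list nat) (K : C -> C) : Prop :=
  meromorphic K /\
  forall s : C, abscissa b A < Re s ->
    @is_series C_AbsRing C_NormedModule (restricted_term b A s) (K s).

Definition candidate_pole (b : nat) (A : list nat) (m : nat) (k : Z) : C :=
  (RtoC (abscissa b A) - RtoC (INR m)
   + RtoC (IZR k) * (RtoC 2 * RtoC PI * Ci / RtoC (ln (INR b))))%C.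

(* Main.v *)
Require Import Defs.
From Stdlib Require Import Reals List ZArith.
From Coquelicot Require Import Coquelicot.
From Stdlib Require Import Lia Lra ClassicalEpsilon Wf_nat.

(** Sorting the admissible integers by their last digit and expanding
    [(b n + a)^-s] by the binomial series gives, for every [J],
    [(1 - N b^-s) K(s) = b^-s sum_(1 <= j <= J) binom(-s, j) g_j K(s + j) + H(s)]
    with [g_j = sum_(a in A) (a / b)^j] and [H] analytic for
    [Re s > s_0 - J - 1]; the identity theorem carries it from [Re s > s_0] to
    that half-plane.  Comparing residues yields
    [Res(s_(m,k)) = (1 - s_(0,k)) ... (m - s_(0,k)) c_m Res(s_(0,k))] with [c_m]
    independent of [k].  The residue at [s_0] is non-zero by positivity, and the
    product does not vanish, except at [k = 0] when [s_0 = 1].  In that case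
    all digits are allowed, [K] is the zeta function, and comparing the
    equations for the bases [b] and [b + 1] shows that it has no pole at
    [s_(0,k)] for [k <> 0].

    Analyticity is handled through power series with an explicit bound on
    [sum |a_i| r^i]: such functions form a Banach algebra, so that no Cauchy
    theory is needed to multiply and to sum them. *)

Open Scope R_scope.

(** * Finite sums and convergence of complex series *)

(** The recursion for the residues along a line of poles involves k only through binomial
    coefficients, since N b^(-s) takes the value b^m at s_(m,k) for every k. The identity binom(m -
    s, j) (1 - s) ... (m - j - s) = (1 - s) ... (m - s) / j! at s = s_(0,k) then carries the
    dependence on k out of the recursion. Whether c_m vanishes stays open: the equivalence reads it
    off from s_(m,0). The product is non-zero for k <> 0 because s_(0,k) is not real, and for k = 0
    because s_0 lies in [0, 1] and equals 1 only when all digits are allowed.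

    The bases b and b + 1 are compared because no positive power of b + 1 is a power of b, so that 1
    - b^(1-s) and 1 - (b+1)^(1-s) have only s = 1 as a common zero.

    A meromorphic function is here a total function with arbitrary values at its poles. Equations
    between such functions are therefore stated on punctured discs, and residues are limits of (z -
    z0) K(z). *)

Fixpoint Csum (f : nat -> C) (n : nat) : C :=
  match n with O => RtoC 0 | S p => (Csum f p + f p)%C end.

Fixpoint Rsum (f : nat -> R) (n : nat) : R :=
  match n with O => 0 | S p => Rsum f p + f p end.

Lemma Csum_ext f g n : (forall i, (i < n)%nat -> f i = g i) -> Csum f n = Csum g n.
Proof.
  induction n as [|n IH]; intros H; simpl; [reflexivity|].
  rewrite IH, H; auto with arith.
Qed.

Lemma Csum_zero f n : (forall i, (i < n)%nat -> f i = RtoC 0) -> Csum f n = RtoC 0.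
Proof.
  induction n as [|n IH]; intros H; simpl; [reflexivity|].
  rewrite IH, H; auto with arith. ring.
Qed.

Lemma Csum_plus f g n : Csum (fun i => f i + g i)%C n = (Csum f n + Csum g n)%C.
Proof. induction n as [|n IH]; simpl; [|rewrite IH]; ring. Qed.

Lemma Csum_scal c f n : Csum (fun i => c * f i)%C n = (c * Csum f n)%C.
Proof. induction n as [|n IH]; simpl; [|rewrite IH]; ring. Qed.

Lemma Csum_swap f n m :
  Csum (fun i => Csum (fun j => f i j) m) n = Csum (fun j => Csum (fun i => f i j) n) m.
Proof.
  induction n as [|n IH]; simpl.
  - symmetry; apply Csum_zero; auto.
  - rewrite IH, <- Csum_plus. reflexivity.
Qed.

Lemma Csum_app f n m : Csum f (n + m) = (Csum f n + Csum (fun i => f (n + i)%nat) m)%C.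
Proof.
  induction m as [|m IH]; simpl.
  - rewrite Nat.add_0_r. ring.
  - rewrite Nat.add_succ_r. simpl. rewrite IH. ring.
Qed.

Lemma Csum_shift f n : Csum f (S n) = (f 0%nat + Csum (fun i => f (S i)) n)%C.
Proof. change (S n) with (1 + n)%nat. rewrite Csum_app. simpl. ring. Qed.

Lemma Csum_RtoC f n : Csum (fun i => RtoC (f i)) n = RtoC (Rsum f n).
Proof. induction n as [|n IH]; simpl; [|rewrite IH, RtoC_plus]; reflexivity. Qed.

Lemma Rsum_ext f g n : (forall i, (i < n)%nat -> f i = g i) -> Rsum f n = Rsum g n.
Proof.
  induction n as [|n IH]; intros H; simpl; [reflexivity|].
  rewrite IH, H; auto with arith.
Qed.

Lemma Rsum_le f g n : (forall i, (i < n)%nat -> f i <= g i) -> Rsum f n <= Rsum g n.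
Proof.
  induction n as [|n IH]; intros H; simpl; [lra|].
  apply Rplus_le_compat; auto with arith.
Qed.

Lemma Rsum_nonneg f n : (forall i, 0 <= f i) -> 0 <= Rsum f n.
Proof.
  intros H; induction n as [|n IH]; simpl; [lra|]. specialize (H n); lra.
Qed.

Lemma Rsum_plus f g n : Rsum (fun i => f i + g i) n = Rsum f n + Rsum g n.
Proof. induction n as [|n IH]; simpl; [|rewrite IH]; ring. Qed.

Lemma Rsum_scal c f n : Rsum (fun i => c * f i) n = c * Rsum f n.
Proof. induction n as [|n IH]; simpl; [|rewrite IH]; ring. Qed.

Lemma Rsum_swap f n m :
  Rsum (fun i => Rsum (fun j => f i j) m) n = Rsum (fun j => Rsum (fun i => f i j) n) m.
Proof.
  induction n as [|n IH]; simpl.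
  - induction m as [|m IHm]; simpl; [reflexivity|rewrite <- IHm; ring].
  - rewrite IH, <- Rsum_plus. reflexivity.
Qed.

Lemma Rsum_app f n m : Rsum f (n + m) = Rsum f n + Rsum (fun i => f (n + i)%nat) m.
Proof.
  induction m as [|m IH]; simpl.
  - rewrite Nat.add_0_r. ring.
  - rewrite Nat.add_succ_r. simpl. rewrite IH. ring.
Qed.

Lemma Rsum_shift f n : Rsum f (S n) = f 0%nat + Rsum (fun i => f (S i)) n.
Proof. change (S n) with (1 + n)%nat. rewrite Rsum_app. simpl. ring. Qed.

Lemma Rsum_monotone f n m : (forall i, 0 <= f i) -> (n <= m)%nat -> Rsum f n <= Rsum f m.
Proof.
  intros H L. replace m with (n + (m - n))%nat by lia. rewrite Rsum_app.
  pose proof (Rsum_nonneg (fun i => f (n + i)%nat) (m - n) (fun i => H _)). lra.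
Qed.

Lemma Cmod_Csum f n : Cmod (Csum f n) <= Rsum (fun i => Cmod (f i)) n.
Proof.
  induction n as [|n IH]; simpl; [rewrite Cmod_0; lra|].
  eapply Rle_trans; [apply Cmod_triangle|]. lra.
Qed.

(** [Rsum f n] and [Csum f n] stop before index n, whereas the library sum includes it; hence
    [S n]. *)
Lemma Rsum_sum_n f n : sum_n f n = Rsum f (S n).
Proof.
  induction n as [|n IH].
  - rewrite sum_O. symmetry. apply Rplus_0_l.
  - rewrite sum_Sn, IH. reflexivity.
Qed.

Lemma Csum_sum_n (f : nat -> C) n : @sum_n C_AbelianMonoid f n = Csum f (S n).
Proof.
  induction n as [|n IH].
  - rewrite sum_O. symmetry. apply Cplus_0_l.
  - rewrite sum_Sn, IH. reflexivity.
Qed.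

Lemma Cmod_minus_sym x y : Cmod (x - y) = Cmod (y - x).
Proof. rewrite <- Cmod_opp. f_equal. ring. Qed.

Lemma Cmod_triangle_minus x y z : Cmod (x - z) <= Cmod (x - y) + Cmod (y - z).
Proof. replace (x - z)%C with ((x - y) + (y - z))%C by ring. apply Cmod_triangle. Qed.

(** Convergence in terms of [Cmod], so that estimates stay elementary; [csums_is_series] connects it
    with the filters of the library. *)
Definition ctends (u : nat -> C) (l : C) : Prop :=
  forall eps, 0 < eps -> exists N, forall n, (N <= n)%nat -> Cmod (u n - l) < eps.

Lemma ctends_ext u v l : (forall n, u n = v n) -> ctends u l -> ctends v l.
Proof.
  intros E H eps He. destruct (H eps He) as [N HN]. exists N. intros n Hn.
  rewrite <- E. auto.
Qed.

Lemma ctends_const l : ctends (fun _ => l) l.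
Proof.
  intros eps He. exists 0%nat. intros n _. replace (l - l)%C with (RtoC 0) by ring.
  rewrite Cmod_0. exact He.
Qed.

Lemma ctends_plus u v l m : ctends u l -> ctends v m -> ctends (fun n => u n + v n)%C (l + m)%C.
Proof.
  intros Hu Hv eps He.
  destruct (Hu (eps / 2)) as [N1 H1]; [lra|]. destruct (Hv (eps / 2)) as [N2 H2]; [lra|].
  exists (N1 + N2)%nat. intros n Hn.
  replace (u n + v n - (l + m))%C with ((u n - l) + (v n - m))%C by ring.
  eapply Rle_lt_trans; [apply Cmod_triangle|].
  specialize (H1 n ltac:(lia)). specialize (H2 n ltac:(lia)). lra.
Qed.

Lemma ctends_scal c u l : ctends u l -> ctends (fun n => c * u n)%C (c * l)%C.
Proof.
  intros Hu eps He. pose proof (Cmod_ge_0 c).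
  destruct (Hu (eps / (Cmod c + 1))) as [N HN]; [apply Rdiv_lt_0_compat; lra|].
  exists N. intros n Hn. specialize (HN n Hn).
  replace (c * u n - c * l)%C with (c * (u n - l))%C by ring. rewrite Cmod_mult.
  pose proof (Cmod_ge_0 (u n - l)%C).
  apply Rmult_lt_compat_r with (r := Cmod c + 1) in HN; [|lra].
  unfold Rdiv in HN. rewrite Rmult_assoc, Rinv_l, Rmult_1_r in HN by lra. nra.
Qed.

(** Closed discs contain their limit points. Bounds on sums of series are reduced to bounds on
    finite sums in this way. *)
Lemma ctends_dist_le u l x M N :
  ctends u l -> (forall n, (N <= n)%nat -> Cmod (u n - x) <= M) -> Cmod (l - x) <= M.
Proof.
  intros Hu H. apply Rle_plus_epsilon. intros eps He.
  destruct (Hu eps He) as [N1 H1].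
  specialize (H1 (N + N1)%nat ltac:(lia)). specialize (H (N + N1)%nat ltac:(lia)).
  pose proof (Cmod_triangle_minus l (u (N + N1)%nat) x).
  rewrite (Cmod_minus_sym l (u _)) in H0. lra.
Qed.


Lemma Cmod_le_0_eq x y : (forall eps, 0 < eps -> Cmod (x - y) <= eps) -> x = y.
Proof.
  intros H.
  assert (E : (x - y)%C = RtoC 0).
  { apply Cmod_eq_0. apply Rle_antisym; [|apply Cmod_ge_0].
    apply Rle_plus_epsilon. intros eps He. rewrite Rplus_0_l. auto. }
  replace x with ((x - y) + y)%C by ring. rewrite E. ring.
Qed.

Lemma ctends_unique u l m : ctends u l -> ctends u m -> l = m.
Proof.
  intros Hl Hm. apply Cmod_le_0_eq. intros eps He.
  destruct (Hm eps He) as [N HN]. apply (ctends_dist_le u l m eps N Hl).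
  intros n Hn. left. auto.
Qed.

Lemma ctends_Csum (u : nat -> nat -> C) (l : nat -> C) n :
  (forall i, (i < n)%nat -> ctends (fun k => u k i) (l i)) ->
  ctends (fun k => Csum (u k) n) (Csum l n).
Proof.
  induction n as [|n IH]; intros H; simpl.
  - apply ctends_const.
  - apply ctends_plus; auto.
Qed.

Lemma ctends_sub (phi : nat -> nat) u l :
  (forall n, (n <= phi n)%nat) -> ctends u l -> ctends (fun n => u (phi n)) l.
Proof.
  intros Hp H eps He. destruct (H eps He) as [N HN]. exists N. intros n Hn.
  apply HN. specialize (Hp n). lia.
Qed.

Lemma ctends_shift u l : ctends (fun n => u (S n)) l <-> ctends u l.
Proof.
  split; intros H.
  - intros eps He. destruct (H eps He) as [N HN]. exists (S N). intros n Hn.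
    destruct n as [|n]; [lia|]. apply HN. lia.
  - apply (ctends_sub S); auto.
Qed.

Definition csums (a : nat -> C) (l : C) : Prop := ctends (Csum a) l.

Lemma csums_is_series (a : nat -> C) (l : C) :
  csums a l <-> @is_series C_AbsRing C_NormedModule a l.
Proof.
  unfold csums. rewrite <- ctends_shift. split; intros H.
  - unfold is_series. eapply filterlim_ext.
    { intros n. symmetry. apply (Csum_sum_n a n). }
    apply filterlim_locally. intros eps.
    destruct (H eps (cond_pos eps)) as [N HN]. exists N. intros n Hn.
    apply (C_NormedModule_mixin_compat1 l (Csum a (S n)) eps). apply HN, Hn.
  - intros eps He. unfold is_series in H.
    (* Balls of the uniform structure on [C] are squares; a square of half-side r lies in the disc
       of radius sqrt 2 * r. *)
    assert (Hp : 0 < eps / sqrt 2) by (apply Rdiv_lt_0_compat; [lra|apply sqrt_lt_R0; lra]).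
    destruct (proj1 (@filterlim_locally nat C_UniformSpace eventually _ _ l) H
                (mkposreal _ Hp)) as [N HN]. exists N. intros n Hn. specialize (HN n Hn).
    apply (C_NormedModule_mixin_compat2 _ _ (mkposreal _ Hp)) in HN.
    rewrite <- (Csum_sum_n a n). eapply Rlt_le_trans; [exact HN|].
    right. simpl. field. apply Rgt_not_eq, sqrt_lt_R0; lra.
Qed.

Lemma csums_ext a b l : (forall n, a n = b n) -> csums a l -> csums b l.
Proof.
  intros E. apply ctends_ext. intros n. apply Csum_ext. auto.
Qed.

Lemma csums_plus a b l m : csums a l -> csums b m -> csums (fun n => a n + b n)%C (l + m)%C.
Proof.
  intros Ha Hb. apply (ctends_ext (fun n => Csum a n + Csum b n)%C).
  - intros n. rewrite Csum_plus. reflexivity.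
  - apply ctends_plus; assumption.
Qed.

Lemma csums_scal c a l : csums a l -> csums (fun n => c * a n)%C (c * l)%C.
Proof.
  intros Ha. apply (ctends_ext (fun n => c * Csum a n)%C).
  - intros n. rewrite Csum_scal. reflexivity.
  - apply ctends_scal; assumption.
Qed.

Lemma csums_Csum (u : nat -> nat -> C) (l : nat -> C) m :
  (forall i, (i < m)%nat -> csums (u i) (l i)) ->
  csums (fun n => Csum (fun i => u i n) m) (Csum l m).
Proof.
  induction m as [|m IH]; intros H; simpl.
  - apply (ctends_ext (fun _ => RtoC 0)).
    + intros n. symmetry. apply Csum_zero. auto.
    + apply ctends_const.
  - apply csums_plus; auto.
Qed.

Lemma csums_shift a l : csums (fun n => a (S n)) l <-> csums a (a 0%nat + l)%C.
Proof.
  unfold csums. split; intros H.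
  - apply ctends_shift. apply (ctends_ext (fun n => a 0%nat + Csum (fun i => a (S i)) n)%C).
    + intros n. rewrite Csum_shift. reflexivity.
    + apply ctends_plus; [apply ctends_const|exact H].
  - apply ctends_shift in H.
    apply (ctends_ext (fun n => - a 0%nat + Csum a (S n))%C).
    + intros n. rewrite Csum_shift. ring.
    + replace l with (- a 0%nat + (a 0%nat + l))%C by ring.
      apply ctends_plus; [apply ctends_const|exact H].
Qed.

Lemma bounded_partial_sums_ex_series (a : nat -> R) M :
  (forall n, 0 <= a n) -> (forall n, Rsum a n <= M) -> ex_series a.
Proof.
  intros Ha HM. destruct (ex_finite_lim_seq_incr (sum_n a) M) as [l Hl].
  - intros n. rewrite !Rsum_sum_n. simpl. specialize (Ha (S n)). lra.
  - intros n. rewrite Rsum_sum_n. apply HM.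
  - exists l. exact Hl.
Qed.

(** Majorants come with a bound on their partial sums, the form in which [ana] supplies them. *)
Lemma csums_absolute (a : nat -> C) (m : nat -> R) M :
  (forall n, Cmod (a n) <= m n) -> (forall n, Rsum m n <= M) -> exists l, csums a l.
Proof.
  intros Ha HM.
  assert (H : ex_series m).
  { apply (bounded_partial_sums_ex_series m M); [|exact HM].
    intros n. eapply Rle_trans; [apply Cmod_ge_0|apply Ha]. }
  destruct (@ex_series_le C_AbsRing C_CompleteNormedModule a m Ha H) as [l Hl].
  exists l. apply csums_is_series. exact Hl.
Qed.

Lemma csums_Cmod_le a (m : nat -> R) l M :
  csums a l -> (forall n, Cmod (a n) <= m n) -> (forall n, Rsum m n <= M) -> Cmod l <= M.
Proof.
  intros Hl Ha HM. replace l with (l - 0)%C by ring.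
  apply (ctends_dist_le (Csum a) l 0 M 0 Hl). intros n _.
  replace (Csum a n - 0)%C with (Csum a n) by ring.
  eapply Rle_trans; [apply Cmod_Csum|]. eapply Rle_trans; [apply Rsum_le; intros; apply Ha|apply HM].
Qed.

Lemma bounded_partial_sums_tail (m : nat -> R) M eps :
  (forall n, 0 <= m n) -> (forall n, Rsum m n <= M) -> 0 < eps ->
  exists N, forall n, (N <= n)%nat -> Rsum m n <= Rsum m N + eps.
Proof.
  intros Hm HM He.
  destruct (completeness (fun x => exists n, x = Rsum m n)) as [l [Hub Hl]].
  - exists M. intros x [n ->]. apply HM.
  - exists (Rsum m 0), 0%nat. reflexivity.
  - destruct (excluded_middle_informative (exists N, l - eps <= Rsum m N)) as [[N HN]|Hn].
    + exists N. intros n _. specialize (Hub (Rsum m n) (ex_intro _ n eq_refl)). lra.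
    + exfalso. assert (l <= l - eps); [|lra]. apply Hl. intros x [n ->].
      apply Rnot_lt_le. intros Hlt. apply Hn. exists n. lra.
Qed.

Lemma Csum_dist_le (a : nat -> C) (m : nat -> R) N n :
  (forall i, Cmod (a i) <= m i) -> (N <= n)%nat ->
  Cmod (Csum a n - Csum a N) <= Rsum m n - Rsum m N.
Proof.
  intros Ha Hn. replace n with (N + (n - N))%nat by lia. rewrite Csum_app, Rsum_app.
  replace (Csum a N + Csum (fun i => a (N + i)%nat) (n - N) - Csum a N)%C
    with (Csum (fun i => a (N + i)%nat) (n - N)) by ring.
  eapply Rle_trans; [apply Cmod_Csum|].
  replace (Rsum m N + Rsum (fun i => m (N + i)%nat) (n - N) - Rsum m N)
    with (Rsum (fun i => m (N + i)%nat) (n - N)) by ring.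
  apply Rsum_le. intros; apply Ha.
Qed.

(** Dominated convergence for series: beyond a common rank [N] all tails are at most eps / 4,
    uniformly in the parameter, and the partial sums up to [N] converge termwise. *)
Lemma tannery (S : nat -> nat -> C) (f : nat -> C) (m : nat -> R) (sigma : nat -> C) F M :
  (forall I n, Cmod (S I n) <= m n) -> (forall n, Rsum m n <= M) ->
  (forall n, ctends (fun I => S I n) (f n)) ->
  (forall I, csums (S I) (sigma I)) -> csums f F -> ctends sigma F.
Proof.
  intros HS HM Hf Hsig HF eps He.
  assert (Hm : forall n, 0 <= m n).
  { intros n. eapply Rle_trans; [apply Cmod_ge_0|apply (HS 0%nat)]. }
  assert (Hfm : forall n, Cmod (f n) <= m n).
  { intros n. replace (f n) with (f n - 0)%C by ring.
    apply (ctends_dist_le (fun I => S I n) (f n) 0 (m n) 0 (Hf n)). intros I _.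
    replace (S I n - 0)%C with (S I n) by ring. apply HS. }
  destruct (bounded_partial_sums_tail m M (eps / 4) Hm HM) as [N HN]; [lra|].
  assert (Htail : forall a l, (forall i, Cmod (a i) <= m i) -> csums a l ->
             Cmod (l - Csum a N) <= eps / 4).
  { intros a l Ha Hl. apply (ctends_dist_le (Csum a) l _ _ N Hl). intros n Hn.
    eapply Rle_trans; [apply (Csum_dist_le a m N n Ha Hn)|]. specialize (HN n Hn). lra. }
  destruct (ctends_Csum S f N (fun i _ => Hf i) (eps / 4)) as [I0 HI0]; [lra|].
  exists I0. intros I HI. specialize (HI0 I HI).
  pose proof (Htail _ _ (HS I) (Hsig I)). pose proof (Htail _ _ Hfm HF).
  pose proof (Cmod_triangle_minus (sigma I) (Csum (S I) N) F).
  pose proof (Cmod_triangle_minus (Csum (S I) N) (Csum f N) F).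
  rewrite (Cmod_minus_sym (Csum f N) F) in *. lra.
Qed.

(** * Analytic and meromorphic germs *)

Lemma Cminus_0_r x : (x - 0)%C = x.
Proof. ring. Qed.

(** Radius and bound are parameters rather than existentially quantified, so that the bounds of
    infinitely many functions on one disc can be added up in [ana_series]. *)
Definition ana (f : C -> C) (z0 : C) (r M : R) : Prop :=
  0 < r /\
  exists a : nat -> C,
    (forall n, Rsum (fun i => Cmod (a i) * r ^ i) n <= M) /\
    forall z, Cmod (z - z0) < r -> csums (fun i => a i * (z - z0) ^ i)%C (f z).

Lemma ana_ext f g z0 r M :
  (forall z, Cmod (z - z0) < r -> f z = g z) -> ana f z0 r M -> ana g z0 r M.
Proof.
  intros E [Hr [a [Ha Hf]]]. split; [exact Hr|]. exists a. split; [exact Ha|].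
  intros z Hz. rewrite <- E by exact Hz. auto.
Qed.

Lemma ana_weaken f z0 r M N : M <= N -> ana f z0 r M -> ana f z0 r N.
Proof.
  intros E [Hr [a [Ha Hf]]]. split; [exact Hr|]. exists a. split; [|exact Hf].
  intros n. specialize (Ha n). lra.
Qed.

Lemma ana_restrict f z0 r s M : 0 < s <= r -> ana f z0 r M -> ana f z0 s M.
Proof.
  intros Hs [Hr [a [Ha Hf]]]. split; [lra|]. exists a. split.
  - intros n. eapply Rle_trans; [|apply (Ha n)]. apply Rsum_le. intros i _.
    apply Rmult_le_compat_l; [apply Cmod_ge_0|]. apply pow_incr. lra.
  - intros z Hz. apply Hf. lra.
Qed.

Lemma ana_M_nonneg f z0 r M : ana f z0 r M -> 0 <= M.
Proof. intros [_ [a [Ha _]]]. apply (Ha 0%nat). Qed.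

Lemma ana_scal c f z0 r M : ana f z0 r M -> ana (fun z => c * f z)%C z0 r (Cmod c * M).
Proof.
  intros [Hr [a [Ha Hf]]]. split; [exact Hr|]. exists (fun i => c * a i)%C. split.
  - intros n. rewrite (Rsum_ext _ (fun i => Cmod c * (Cmod (a i) * r ^ i))).
    + rewrite Rsum_scal. apply Rmult_le_compat_l; [apply Cmod_ge_0|apply Ha].
    + intros i _. rewrite Cmod_mult. ring.
  - intros z Hz. apply (csums_ext (fun i => c * (a i * (z - z0) ^ i))%C).
    + intros i. ring.
    + apply csums_scal. auto.
Qed.

Lemma ana_plus f g z0 r M N :
  ana f z0 r M -> ana g z0 r N -> ana (fun z => f z + g z)%C z0 r (M + N).
Proof.
  intros [Hr [a [Ha Hf]]] [_ [b [Hb Hg]]]. split; [exact Hr|].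
  exists (fun i => a i + b i)%C. split.
  - intros n. eapply Rle_trans; [|apply (Rplus_le_compat _ _ _ _ (Ha n) (Hb n))].
    rewrite <- Rsum_plus. apply Rsum_le. intros i _.
    rewrite <- Rmult_plus_distr_r. apply Rmult_le_compat_r; [apply pow_le; lra|].
    apply Cmod_triangle.
  - intros z Hz. apply (csums_ext (fun i => a i * (z - z0) ^ i + b i * (z - z0) ^ i)%C).
    + intros i. ring.
    + apply csums_plus; auto.
Qed.

Lemma ana_mul_id f z0 r M : ana f z0 r M -> ana (fun z => (z - z0) * f z)%C z0 r (r * M).
Proof.
  intros [Hr [a [Ha Hf]]]. split; [exact Hr|].
  exists (fun i => match i with O => RtoC 0 | S j => a j end). split.
  - intros [|n].
    + simpl. specialize (Ha 0%nat). simpl in Ha. nra.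
    + rewrite Rsum_shift. rewrite Cmod_0, Rmult_0_l, Rplus_0_l.
      rewrite (Rsum_ext _ (fun i => r * (Cmod (a i) * r ^ i))).
      * rewrite Rsum_scal. apply Rmult_le_compat_l; [lra|apply Ha].
      * intros i _. simpl. ring.
  - intros z Hz.
    replace ((z - z0) * f z)%C with (0 * (z - z0) ^ 0 + (z - z0) * f z)%C by ring.
    apply (csums_shift (fun i => match i with O => RtoC 0 | S j => a j end * (z - z0) ^ i)%C).
    apply (csums_ext (fun i => (z - z0) * (a i * (z - z0) ^ i))%C).
    + intros i. rewrite Cpow_S. ring.
    + apply csums_scal. auto.
Qed.

Lemma ana_mul_pow f z0 r M k :
  ana f z0 r M -> ana (fun z => (z - z0) ^ k * f z)%C z0 r (r ^ k * M).
Proof.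
  intros H. induction k as [|k IH].
  - apply (ana_ext f); [intros; simpl; ring|]. simpl. rewrite Rmult_1_l. exact H.
  - apply (ana_ext (fun z => (z - z0) * ((z - z0) ^ k * f z))%C).
    + intros. rewrite Cpow_S. ring.
    + simpl. rewrite Rmult_assoc. apply ana_mul_id, IH.
Qed.

Lemma ana_const c z0 r : 0 < r -> ana (fun _ => c) z0 r (Cmod c).
Proof.
  intros Hr. split; [exact Hr|].
  exists (fun i => match i with O => c | S _ => RtoC 0 end). split.
  - intros [|n].
    + simpl. apply Cmod_ge_0.
    + rewrite Rsum_shift. rewrite (Rsum_ext _ (fun _ => 0 * 0)).
      * rewrite Rsum_scal. simpl. lra.
      * intros i _. rewrite Cmod_0. ring.
  - intros z _.
    set (a := fun i => (match i with O => c | S _ => RtoC 0 end * (z - z0) ^ i)%C).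
    cut (csums a (a 0%nat + 0)%C).
    { replace (a 0%nat + 0)%C with c by (unfold a; simpl; ring). auto. }
    apply csums_shift. unfold a.
    apply (ctends_ext (fun _ => RtoC 0)); [|apply ctends_const].
    intros n. symmetry. apply Csum_zero. intros. ring.
Qed.

Lemma ana_id z0 r : 0 < r -> ana (fun z => z) z0 r (Cmod z0 + r).
Proof.
  intros Hr. apply (ana_ext (fun z => z0 + (z - z0) * 1)%C); [intros; ring|].
  apply ana_plus; [apply ana_const, Hr|].
  replace r with (r * Cmod 1) at 2 by (rewrite Cmod_1; ring).
  apply ana_mul_id, ana_const, Hr.
Qed.

Lemma ctends_Cmod u l : ctends u l -> ctends (fun n => RtoC (Cmod (u n))) (RtoC (Cmod l)).
Proof.
  intros H eps He. destruct (H eps He) as [N HN]. exists N. intros n Hn.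
  rewrite <- RtoC_minus, Cmod_R. specialize (HN n Hn).
  pose proof (Cmod_triangle (u n - l) l). pose proof (Cmod_triangle (l - u n) (u n)).
  replace (u n - l + l)%C with (u n) in H0 by ring.
  replace (l - u n + u n)%C with l in H1 by ring.
  rewrite (Cmod_minus_sym l) in H1. apply Rabs_def1; lra.
Qed.

(** The coefficient bound passes to a limit of power series, because for each fixed number [k] of
    coefficients the weighted sum is continuous. The real sum is viewed in [C] in order to use
    [ctends_dist_le]. *)
Lemma Rsum_Cmod_limit_le (u : nat -> nat -> C) (l : nat -> C) (w : nat -> R) k B :
  (forall i, ctends (fun n => u n i) (l i)) ->
  (forall n, Rsum (fun i => Cmod (u n i) * w i) k <= B) ->
  (forall n, 0 <= Rsum (fun i => Cmod (u n i) * w i) k) ->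
  Rsum (fun i => Cmod (l i) * w i) k <= B.
Proof.
  intros Hu HB H0.
  assert (T : ctends (fun n => Csum (fun i => RtoC (w i) * RtoC (Cmod (u n i)))%C k)
                     (Csum (fun i => RtoC (w i) * RtoC (Cmod (l i)))%C k)).
  { apply (ctends_Csum (fun n i => RtoC (w i) * RtoC (Cmod (u n i)))%C).
    intros i _. apply ctends_scal, ctends_Cmod, Hu. }
  assert (E : forall v : nat -> C, Csum (fun i => RtoC (w i) * RtoC (Cmod (v i)))%C k
                = RtoC (Rsum (fun i => Cmod (v i) * w i) k)).
  { intros v. rewrite <- Csum_RtoC. apply Csum_ext. intros i _.
    rewrite RtoC_mult. ring. }
  pose proof (ctends_dist_le _ _ 0 B 0 T) as D.
  eapply Rle_trans; [apply Rle_abs|]. rewrite <- Cmod_R, <- E, <- (Cminus_0_r (Csum _ k)).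
  apply D. intros n _. rewrite E, Cminus_0_r, Cmod_R, Rabs_pos_eq; auto.
Qed.

Lemma Rsum_term_le (a : nat -> R) i n : (forall j, 0 <= a j) -> (i < n)%nat -> a i <= Rsum a n.
Proof.
  intros Ha Hi. apply Rle_trans with (Rsum a (S i)); [|apply Rsum_monotone; auto].
  simpl. pose proof (Rsum_nonneg a i Ha). lra.
Qed.

(** Completeness of the algebra. The i-th coefficients are at most [M n / r ^ i], hence summable
    over n; that the resulting power series represents [F] is an interchange of two sums, justified
    by [tannery] with majorant [M]. *)
Lemma ana_series (f : nat -> C -> C) (F : C -> C) z0 r (M : nat -> R) B :
  (forall n, ana (f n) z0 r (M n)) -> (forall n, Rsum M n <= B) ->
  (forall z, Cmod (z - z0) < r -> csums (fun n => f n z) (F z)) -> ana F z0 r B.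
Proof.
  intros Hf HB HF.
  assert (Hr : 0 < r) by apply (Hf 0%nat).
  set (c := fun n => proj1_sig (constructive_indefinite_description _ (proj2 (Hf n)))).
  assert (Hc : forall n,
    (forall k, Rsum (fun i => Cmod (c n i) * r ^ i) k <= M n) /\
    forall z, Cmod (z - z0) < r -> csums (fun i => c n i * (z - z0) ^ i)%C (f n z)).
  { intros n. exact (proj2_sig (constructive_indefinite_description _ (proj2 (Hf n)))). }
  clearbody c.
  assert (Hpos : forall n i, 0 <= Cmod (c n i) * r ^ i).
  { intros. apply Rmult_le_pos; [apply Cmod_ge_0|apply pow_le; lra]. }
  assert (HA : forall i, exists A, csums (fun n => c n i) A).
  { intros i. pose proof (pow_lt r i Hr) as Hri.
    apply (csums_absolute _ (fun n => / r ^ i * M n) (/ r ^ i * B)).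
    - intros n. apply Rmult_le_reg_l with (r ^ i); [exact Hri|].
      rewrite <- Rmult_assoc, Rinv_r, Rmult_1_l by lra. rewrite Rmult_comm.
      eapply Rle_trans; [|apply (proj1 (Hc n) (S i))].
      apply (Rsum_term_le (fun i => Cmod (c n i) * r ^ i)); auto.
    - intros n. rewrite Rsum_scal. apply Rmult_le_compat_l; [|apply HB].
      left. apply Rinv_0_lt_compat, Hri. }
  set (A := fun i => proj1_sig (constructive_indefinite_description _ (HA i))).
  assert (HA' : forall i, csums (fun n => c n i) (A i)).
  { intros i. exact (proj2_sig (constructive_indefinite_description _ (HA i))). }
  clearbody A.
  split; [exact Hr|]. exists A. split.
  - intros k. apply (Rsum_Cmod_limit_le (fun n i => Csum (fun n => c n i) n)).
    + exact HA'.
    + intros n. eapply Rle_trans; [|apply (HB n)].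
      apply Rle_trans with (Rsum (fun i => Rsum (fun n => Cmod (c n i) * r ^ i) n) k).
      * apply Rsum_le. intros i _.
        rewrite (Rsum_ext (fun n => Cmod (c n i) * r ^ i) (fun n => r ^ i * Cmod (c n i)))
          by (intros; ring).
        rewrite Rsum_scal, Rmult_comm. apply Rmult_le_compat_l; [apply pow_le; lra|].
        apply Cmod_Csum.
      * rewrite Rsum_swap. apply Rsum_le. intros j _. apply (Hc j).
    + intros n. apply Rsum_nonneg. intros i.
      apply Rmult_le_pos; [apply Cmod_ge_0|apply pow_le; lra].
  - intros z Hz. unfold csums.
    apply (tannery (fun I n => Csum (fun i => c n i * (z - z0) ^ i)%C I)
             (fun n => f n z) M _ (F z) B).
    + intros I n. eapply Rle_trans; [apply Cmod_Csum|].
      eapply Rle_trans; [|apply (proj1 (Hc n) I)]. apply Rsum_le. intros i _.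
      rewrite Cmod_mult, Cmod_pow. apply Rmult_le_compat_l; [apply Cmod_ge_0|].
      apply pow_incr. split; [apply Cmod_ge_0|lra].
    + exact HB.
    + intros n. apply (proj2 (Hc n) z Hz).
    + intros I. apply (csums_Csum (fun i n => c n i * (z - z0) ^ i)%C).
      intros i _. rewrite Cmult_comm. apply (csums_ext (fun n => (z - z0) ^ i * c n i)%C).
      * intros; ring.
      * apply csums_scal, HA'.
    + apply HF, Hz.
Qed.

(** Completeness replaces the Cauchy product: f g is the sum of the functions a_n (z - z0)^n g(z),
    of norm at most |a_n| r^n N. *)
Lemma ana_mult f g z0 r M N :
  ana f z0 r M -> ana g z0 r N -> ana (fun z => f z * g z)%C z0 r (M * N).
Proof.
  intros [Hr [a [Ha Hf]]] Hg. pose proof (ana_M_nonneg _ _ _ _ Hg) as HN.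
  apply (ana_series (fun n z => a n * ((z - z0) ^ n * g z))%C _ z0 r
           (fun n => Cmod (a n) * (r ^ n * N))).
  - intros n. apply ana_scal, ana_mul_pow, Hg.
  - intros n. rewrite (Rsum_ext _ (fun i => N * (Cmod (a i) * r ^ i))) by (intros; ring).
    rewrite Rsum_scal, Rmult_comm. apply Rmult_le_compat_r; [exact HN|apply Ha].
  - intros z Hz. rewrite Cmult_comm.
    apply (csums_ext (fun n => g z * (a n * (z - z0) ^ n))%C); [intros; ring|].
    apply csums_scal. auto.
Qed.

Lemma ana_Csum (f : nat -> C -> C) z0 r (M : nat -> R) n :
  0 < r -> (forall i, (i < n)%nat -> ana (f i) z0 r (M i)) ->
  ana (fun z => Csum (fun i => f i z) n) z0 r (Rsum M n).
Proof.
  intros Hr. induction n as [|n IH]; intros H; simpl.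
  - apply (ana_weaken _ _ _ (Cmod 0)); [rewrite Cmod_0; lra|]. apply ana_const, Hr.
  - apply ana_plus; auto.
Qed.

(** In the tail, |w|^(k+i) is at most (|w| / r)^k r^(k+i). The case k = 1 gives continuity, k = 2
    the second-order estimate of the exponential, and the order of a zero plus one the isolation of
    zeros. *)
Lemma power_series_remainder a z0 r M z l k :
  0 < r -> (forall n, Rsum (fun i => Cmod (a i) * r ^ i) n <= M) -> Cmod (z - z0) < r ->
  csums (fun i => a i * (z - z0) ^ i)%C l ->
  Cmod (l - Csum (fun i => a i * (z - z0) ^ i)%C k) <= (Cmod (z - z0) / r) ^ k * M.
Proof.
  intros Hr Ha Hz Hl. apply (ctends_dist_le _ _ _ _ k Hl). intros n Hn.
  replace n with (k + (n - k))%nat by lia. rewrite Csum_app.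
  set (w := (z - z0)%C) in *. pose proof (Cmod_ge_0 w) as Hw.
  replace (Csum (fun i => a i * w ^ i)%C k + Csum (fun i => a (k + i)%nat * w ^ (k + i))%C (n - k)
           - Csum (fun i => a i * w ^ i)%C k)%C
    with (Csum (fun i => a (k + i)%nat * w ^ (k + i))%C (n - k)) by ring.
  eapply Rle_trans; [apply Cmod_Csum|].
  apply Rle_trans with
    ((Cmod w / r) ^ k * Rsum (fun i => Cmod (a (k + i)%nat) * r ^ (k + i)) (n - k)).
  - rewrite <- Rsum_scal. apply Rsum_le. intros i _.
    rewrite Cmod_mult, Cmod_pow, !pow_add.
    replace ((Cmod w / r) ^ k * (Cmod (a (k + i)%nat) * (r ^ k * r ^ i)))
      with (Cmod (a (k + i)%nat) * (Cmod w ^ k * r ^ i)).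
    + apply Rmult_le_compat_l; [apply Cmod_ge_0|].
      apply Rmult_le_compat_l; [apply pow_le, Hw|]. apply pow_incr. lra.
    + unfold Rdiv. rewrite Rpow_mult_distr, pow_inv. field. apply pow_nonzero. lra.
  - apply Rmult_le_compat_l.
    + apply pow_le. apply Rdiv_le_0_compat; lra.
    + eapply Rle_trans; [|apply (Ha (k + (n - k))%nat)]. rewrite Rsum_app.
      assert (0 <= Rsum (fun i => Cmod (a i) * r ^ i) k); [|lra].
      apply Rsum_nonneg. intros i. apply Rmult_le_pos; [apply Cmod_ge_0|apply pow_le; lra].
Qed.

Lemma ana_lipschitz f z0 r M z :
  ana f z0 r M -> Cmod (z - z0) < r -> Cmod (f z - f z0) <= Cmod (z - z0) / r * M.
Proof.
  intros [Hr [a [Ha Hf]]] Hz.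
  assert (H0 : Cmod (z0 - z0) = 0) by (replace (z0 - z0)%C with (RtoC 0) by ring; apply Cmod_0).
  assert (E : f z0 = a 0%nat).
  { apply Cmod_le_0_eq. intros eps He.
    assert (H : Cmod (z0 - z0) < r) by lra.
    pose proof (power_series_remainder a z0 r M z0 _ 1 Hr Ha H (Hf z0 H)) as P.
    rewrite H0 in P. simpl in P.
    replace (f z0 - (0 + a 0%nat * 1))%C with (f z0 - a 0%nat)%C in P by ring.
    unfold Rdiv in P. rewrite !Rmult_0_l in P. lra. }
  pose proof (power_series_remainder a z0 r M z _ 1 Hr Ha Hz (Hf z Hz)) as P.
  simpl in P. rewrite Rmult_1_r in P. rewrite E.
  replace (f z - a 0%nat)%C with (f z - (0 + a 0%nat * 1))%C by ring. exact P.
Qed.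

(** With k least such that a_k <> 0, the term a_k w^k exceeds the remainder (|w| / r)^(k+1) M as
    soon as |w| < |a_k| r^(k+1) / (M + 1); here M + 1 keeps the quotient defined when M = 0. *)
Lemma ana_dichotomy f z0 r M :
  ana f z0 r M ->
  (forall z, Cmod (z - z0) < r -> f z = RtoC 0) \/
  exists rho, 0 < rho <= r /\ forall z, 0 < Cmod (z - z0) < rho -> f z <> RtoC 0.
Proof.
  intros Han. pose proof (ana_M_nonneg _ _ _ _ Han) as HM.
  destruct Han as [Hr [a [Ha Hf]]].
  destruct (excluded_middle_informative (exists k, a k <> RtoC 0)) as [Hex|Hno].
  - right.
    destruct (dec_inh_nat_subset_has_unique_least_element (fun k => a k <> RtoC 0))
      as [k [[Hk Hmin] _]].
    { intros n. destruct (excluded_middle_informative (a n <> RtoC 0)); auto. }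
    { exact Hex. }
    assert (Hz : forall i, (i < k)%nat -> a i = RtoC 0).
    { intros i Hi. destruct (excluded_middle_informative (a i = RtoC 0)) as [|Hn]; [assumption|].
      specialize (Hmin i Hn). lia. }
    pose proof (proj1 (Cmod_gt_0 _) Hk) as Hk'.
    pose proof (pow_lt r (S k) Hr) as Hrk.
    set (rho := Cmod (a k) * r ^ S k / (M + 1)).
    assert (Hrho : 0 < rho).
    { apply Rdiv_lt_0_compat; [apply Rmult_lt_0_compat; assumption|lra]. }
    exists (Rmin rho r). split.
    + split; [apply Rmin_glb_lt; assumption|apply Rmin_r].
    + intros z [Hz0 Hz1] Hfz.
      assert (Hzr : Cmod (z - z0) < r) by (eapply Rlt_le_trans; [exact Hz1|apply Rmin_r]).
      assert (Hzrho : Cmod (z - z0) < rho) by (eapply Rlt_le_trans; [exact Hz1|apply Rmin_l]).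
      pose proof (power_series_remainder a z0 r M z _ (S k) Hr Ha Hzr (Hf z Hzr)) as P.
      set (w := (z - z0)%C) in *.
      simpl Csum in P. rewrite (Csum_zero _ k) in P.
      2:{ intros i Hi. rewrite Hz by exact Hi. ring. }
      rewrite Hfz in P. replace (0 - (0 + a k * w ^ k))%C with (- (a k * w ^ k))%C in P by ring.
      rewrite Cmod_opp, Cmod_mult, Cmod_pow in P.
      pose proof (pow_lt (Cmod w) k Hz0) as Hwk.
      unfold Rdiv in P. rewrite Rpow_mult_distr, pow_inv in P. simpl pow in P at 2.
      assert (Q : Cmod (a k) * r ^ S k <= Cmod w * M).
      { apply Rmult_le_reg_r with (Cmod w ^ k * / r ^ S k).
        { apply Rmult_lt_0_compat; [assumption|apply Rinv_0_lt_compat; assumption]. }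
        replace (Cmod (a k) * r ^ S k * (Cmod w ^ k * / r ^ S k)) with (Cmod (a k) * Cmod w ^ k)
          by (field_simplify_eq; [reflexivity|lra]).
        eapply Rle_trans; [exact P|]. simpl. right. ring. }
      unfold rho in Hzrho.
      apply Rmult_lt_compat_r with (r := M + 1) in Hzrho; [|lra].
      unfold Rdiv in Hzrho. rewrite Rmult_assoc, Rinv_l, Rmult_1_r in Hzrho by lra.
      nra.
  - left. intros z Hz. apply (ctends_unique _ _ _ (Hf z Hz)).
    apply (ctends_ext (fun _ => RtoC 0)); [|apply ctends_const].
    intros n. symmetry. apply Csum_zero. intros i _.
    destruct (excluded_middle_informative (a i = RtoC 0)) as [E|Hn].
    + rewrite E. ring.
    + exfalso. apply Hno. exists i. exact Hn.
Qed.

Lemma csums_terms_bounded a l : csums a l -> exists B, forall n, Cmod (a n) <= B.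
Proof.
  intros H. destruct (H 1 Rlt_0_1) as [N HN].
  assert (P : forall n, 0 <= Rsum (fun i => Cmod (a i)) n)
    by (intros; apply Rsum_nonneg; intros; apply Cmod_ge_0).
  (* A late term is the difference of two partial sums, both within 1 of the limit; the finite sum
     takes care of the early terms. *)
  exists (2 + Rsum (fun i => Cmod (a i)) N). intros n.
  destruct (Nat.lt_ge_cases n N) as [L|L].
  - pose proof (Rsum_term_le (fun i => Cmod (a i)) n N (fun i => Cmod_ge_0 _) L) as Q.
    simpl in Q. lra.
  - pose proof (HN n L) as H1. pose proof (HN (S n) ltac:(lia)) as H2.
    pose proof (Cmod_triangle_minus (Csum a (S n)) l (Csum a n)) as H3.
    rewrite (Cmod_minus_sym l) in H3. simpl in H3, H2.
    replace (Csum a n + a n - Csum a n)%C with (a n) in H3 by ring.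
    specialize (P N). lra.
Qed.

Lemma pow_n_Cpow (z : C) n : @pow_n C_Ring z n = (z ^ n)%C.
Proof. induction n as [|n IH]; [reflexivity|]. rewrite Cpow_S, <- IH. reflexivity. Qed.

(** The terms are bounded by some B at distance R0 / 2 from the centre, so at radius R0 / 4 they are
    dominated by B / 2^i, of sum 2 B. *)
Lemma analytic_at_ana f z0 : analytic_at f z0 -> exists r M, ana f z0 r M.
Proof.
  intros [a [R0 [HR H]]].
  assert (H' : forall z, Cmod (z - z0) < R0 -> csums (fun i => a i * (z - z0) ^ i)%C (f z)).
  { intros z Hz. apply csums_is_series. specialize (H z Hz).
    unfold is_pseries in H. eapply is_series_ext; [|exact H].
    intros n. rewrite <- pow_n_Cpow. apply Cmult_comm. }
  assert (E : (z0 + RtoC (R0 / 2) - z0)%C = RtoC (R0 / 2)) by ring.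
  assert (H2 : Cmod (z0 + RtoC (R0 / 2) - z0) < R0).
  { rewrite E, Cmod_R, Rabs_pos_eq; lra. }
  destruct (csums_terms_bounded _ _ (H' _ H2)) as [B HB].
  exists (R0 / 4), (2 * B). split; [lra|]. exists a. split.
  - assert (HB' : forall i, Cmod (a i) * (R0 / 4) ^ i <= B * (1 / 2) ^ i).
    { intros i. specialize (HB i). rewrite E, Cmod_mult, Cmod_pow, Cmod_R, Rabs_pos_eq in HB by lra.
      replace (R0 / 4) with (R0 / 2 * (1 / 2)) by field. rewrite Rpow_mult_distr, <- Rmult_assoc.
      apply Rmult_le_compat_r; [apply pow_le; lra|exact HB]. }
    assert (G : forall n, Rsum (fun i => (1 / 2) ^ i) n = 2 - 2 * (1 / 2) ^ n).
    { induction n as [|n IH]; simpl; [ring|]. rewrite IH. field. }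
    intros n. eapply Rle_trans; [apply Rsum_le; intros; apply HB'|].
    rewrite Rsum_scal, G. pose proof (Cmod_ge_0 (a 0%nat)). specialize (HB 0%nat).
    pose proof (Cmod_ge_0 (a 0%nat * (z0 + (R0 / 2)%R - z0) ^ 0)%C).
    pose proof (pow_lt (1 / 2) n ltac:(lra)). nra.
  - intros z Hz. apply H'. lra.
Qed.

(** * Meromorphic germs and the identity theorem *)

(** [meromorphic] is not stable under sums: poles may cancel and leave an arbitrary value at the
    point. Here [h] may vanish at [z0] and the equation concerns a punctured disc, which makes sums
    and products immediate. *)
Definition mero_at (f : C -> C) (z0 : C) : Prop :=
  exists (p : nat) (r M : R) (h : C -> C), ana h z0 r M /\
    forall z, 0 < Cmod (z - z0) < r -> ((z - z0) ^ p * f z)%C = h z.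

Lemma mero_at_ana f z0 r M : ana f z0 r M -> mero_at f z0.
Proof. intros H. exists 0%nat, r, M, f. split; [exact H|]. intros. simpl. ring. Qed.

Lemma mero_at_plus f g z0 : mero_at f z0 -> mero_at g z0 -> mero_at (fun z => f z + g z)%C z0.
Proof.
  intros [p [r [M [h [Hh Hf]]]]] [q [s [N [k [Hk Hg]]]]].
  assert (Hm : 0 < Rmin r s) by (apply Rmin_glb_lt; [apply Hh|apply Hk]).
  exists (p + q)%nat, (Rmin r s).
  exists (Rmin r s ^ q * M + Rmin r s ^ p * N).
  exists (fun z => (z - z0) ^ q * h z + (z - z0) ^ p * k z)%C. split.
  - apply ana_plus; apply ana_mul_pow; eapply ana_restrict; try eassumption;
      (split; [assumption|]); [apply Rmin_l|apply Rmin_r].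
  - intros z Hz. pose proof (Rmin_l r s). pose proof (Rmin_r r s).
    rewrite <- Hf, <- Hg by lra. rewrite Cpow_add_r. ring.
Qed.

Lemma mero_at_mult f g z0 : mero_at f z0 -> mero_at g z0 -> mero_at (fun z => f z * g z)%C z0.
Proof.
  intros [p [r [M [h [Hh Hf]]]]] [q [s [N [k [Hk Hg]]]]].
  assert (Hm : 0 < Rmin r s) by (apply Rmin_glb_lt; [apply Hh|apply Hk]).
  exists (p + q)%nat, (Rmin r s), (M * N), (fun z => h z * k z)%C. split.
  - apply ana_mult; eapply ana_restrict; try eassumption;
      (split; [assumption|]); [apply Rmin_l|apply Rmin_r].
  - intros z Hz. pose proof (Rmin_l r s). pose proof (Rmin_r r s).
    rewrite <- Hf, <- Hg by lra. rewrite Cpow_add_r. ring.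
Qed.

Lemma mero_at_const c z0 : mero_at (fun _ => c) z0.
Proof. eapply mero_at_ana, (ana_const c z0 1 Rlt_0_1). Qed.

Lemma mero_at_Csum (f : nat -> C -> C) z0 n :
  (forall i, (i < n)%nat -> mero_at (f i) z0) -> mero_at (fun z => Csum (fun i => f i z) n) z0.
Proof.
  induction n as [|n IH]; intros H; simpl.
  - apply mero_at_const.
  - apply mero_at_plus; auto.
Qed.

Lemma ana_translate f z0 c r M : ana f (z0 + c)%C r M -> ana (fun z => f (z + c)%C) z0 r M.
Proof.
  intros [Hr [a [Ha Hf]]]. split; [exact Hr|]. exists a. split; [exact Ha|].
  intros z Hz. replace (z - z0)%C with (z + c - (z0 + c))%C in * by ring. auto.
Qed.

Lemma mero_at_translate f z0 c : mero_at f (z0 + c)%C -> mero_at (fun z => f (z + c)%C) z0.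
Proof.
  intros [p [r [M [h [Hh Hf]]]]]. exists p, r, M, (fun z => h (z + c)%C). split.
  - apply ana_translate, Hh.
  - intros z Hz. replace (z - z0)%C with (z + c - (z0 + c))%C in * by ring. auto.
Qed.

Lemma mero_at_meromorphic f z0 : meromorphic f -> mero_at f z0.
Proof.
  intros Hf. destruct (Hf z0) as [Ha|[p [_ [g [s [Hg [_ [Hs E]]]]]]]].
  - destruct (analytic_at_ana _ _ Ha) as [r [M H]]. eapply mero_at_ana, H.
  - destruct (analytic_at_ana _ _ Hg) as [r [M H]].
    assert (0 < Rmin r s) by (apply Rmin_glb_lt; [apply H|assumption]).
    exists p, (Rmin r s), M, g. split.
    + eapply ana_restrict; [|exact H]. split; [assumption|apply Rmin_l].
    + intros z Hz. pose proof (Rmin_r r s). rewrite E by lra. field.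
      apply Cpow_nz. apply Cmod_gt_0. lra.
Qed.

Definition vanishes_near (f : C -> C) (z0 : C) : Prop :=
  exists rho, 0 < rho /\ forall z, 0 < Cmod (z - z0) < rho -> f z = RtoC 0.

Definition nonzero_near (f : C -> C) (z0 : C) : Prop :=
  exists rho, 0 < rho /\ forall z, 0 < Cmod (z - z0) < rho -> f z <> RtoC 0.

Lemma mero_at_dichotomy f z0 : mero_at f z0 -> vanishes_near f z0 \/ nonzero_near f z0.
Proof.
  intros [p [r [M [h [Hh E]]]]]. destruct (ana_dichotomy _ _ _ _ Hh) as [H|[rho [Hr H]]].
  - left. exists r. split; [apply Hh|]. intros z Hz. specialize (E z Hz).
    rewrite H in E by lra.
    destruct (excluded_middle_informative (f z = RtoC 0)) as [|Hn]; [assumption|].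
    exfalso. revert E. apply Cmult_neq_0; [|exact Hn]. apply Cpow_nz, Cmod_gt_0, Hz.
  - right. exists rho. split; [lra|]. intros z Hz Hf. apply (H z Hz).
    rewrite <- E by lra. rewrite Hf. ring.
Qed.

Lemma punctured_ball_neighbourhood z0 rho z :
  0 < Cmod (z - z0) < rho ->
  exists d, 0 < d /\ forall y, Cmod (y - z) < d -> 0 < Cmod (y - z0) < rho.
Proof.
  intros Hz. exists (Rmin (Cmod (z - z0)) (rho - Cmod (z - z0))). split.
  - apply Rmin_glb_lt; lra.
  - intros y Hy. pose proof (Rmin_l (Cmod (z - z0)) (rho - Cmod (z - z0))).
    pose proof (Rmin_r (Cmod (z - z0)) (rho - Cmod (z - z0))).
    pose proof (Cmod_triangle_minus y z z0). pose proof (Cmod_triangle_minus z y z0).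
    rewrite (Cmod_minus_sym z y) in *. lra.
Qed.

Lemma nonzero_near_not_vanishes f z : nonzero_near f z -> ~ vanishes_near f z.
Proof.
  intros [r [Hr H]] [s [Hs H']].
  assert (0 < Rmin r s) by (apply Rmin_glb_lt; assumption).
  pose proof (Rmin_l r s). pose proof (Rmin_r r s).
  assert (E : Cmod (z + RtoC (Rmin r s / 2) - z) = Rmin r s / 2).
  { replace (z + RtoC (Rmin r s / 2) - z)%C with (RtoC (Rmin r s / 2)) by ring.
    rewrite Cmod_R, Rabs_pos_eq; lra. }
  apply (H (z + RtoC (Rmin r s / 2))%C); [rewrite E; lra|].
  apply H'. rewrite E. lra.
Qed.

(* The indicator function of the set where [f] vanishes nearby is locally
   constant along the segment, hence has derivative zero. *)
Lemma identity_along_segment f z0 d :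
  (forall t, 0 <= t <= 1 -> mero_at f (z0 + RtoC t * d)%C) ->
  vanishes_near f z0 -> vanishes_near f (z0 + d)%C.
Proof.
  intros Hm H0.
  destruct (excluded_middle_informative (d = RtoC 0)) as [Ed|Hd].
  { replace (z0 + d)%C with z0 by (rewrite Ed; ring). exact H0. }
  pose proof (proj1 (Cmod_gt_0 d) Hd) as Hd'.
  set (g := fun t : R => if excluded_middle_informative (vanishes_near f (z0 + RtoC t * d)%C)
                then 1 else 0).
  assert (Hdist : forall t u, Cmod ((z0 + RtoC u * d) - (z0 + RtoC t * d)) = Rabs (u - t) * Cmod d).
  { intros t u. replace ((z0 + RtoC u * d) - (z0 + RtoC t * d))%C with (RtoC (u - t) * d)%C.
    - rewrite Cmod_mult, Cmod_R. reflexivity.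
    - rewrite RtoC_minus. ring. }
  assert (Hloc : forall t, 0 <= t <= 1 -> locally t (fun u => g t = g u)).
  { intros t Ht.
    assert (W : forall rho, 0 < rho -> locally t (fun u => u = t \/
              0 < Cmod ((z0 + RtoC u * d) - (z0 + RtoC t * d)) < rho)).
    { intros rho Hrho.
      assert (Hp : 0 < rho / Cmod d) by (apply Rdiv_lt_0_compat; assumption).
      exists (mkposreal _ Hp). intros u Hu. change (Rabs (u - t) < rho / Cmod d) in Hu.
      destruct (Req_dec u t) as [|Hne]; [left; assumption|right].
      rewrite Hdist. split.
      - apply Rmult_lt_0_compat; [apply Rabs_pos_lt; lra|assumption].
      - apply Rmult_lt_compat_r with (r := Cmod d) in Hu; [|assumption].
        unfold Rdiv in Hu. rewrite Rmult_assoc, Rinv_l, Rmult_1_r in Hu; lra. }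
    destruct (mero_at_dichotomy _ _ (Hm t Ht)) as [Hv|Hv].
    - destruct Hv as [rho [Hrho Hv]]. generalize (W rho Hrho). apply filter_imp.
      intros u [->|Hu]; [reflexivity|].
      destruct (punctured_ball_neighbourhood _ _ _ Hu) as [e [He Hy]].
      unfold g. destruct excluded_middle_informative as [_|n].
      + destruct excluded_middle_informative as [_|n]; [reflexivity|].
        exfalso. apply n. exists e. split; [exact He|]. intros z Hz. apply Hv, Hy, Hz.
      + exfalso. apply n. exists rho. split; assumption.
    - pose proof (nonzero_near_not_vanishes _ _ Hv) as Hnv.
      destruct Hv as [rho [Hrho Hv]]. generalize (W rho Hrho). apply filter_imp.
      intros u [->|Hu]; [reflexivity|].
      destruct (punctured_ball_neighbourhood _ _ _ Hu) as [e [He Hy]].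
      unfold g. destruct excluded_middle_informative as [n|_]; [contradiction|].
      destruct excluded_middle_informative as [n|_]; [|reflexivity].
      exfalso. revert n. apply nonzero_near_not_vanishes.
      exists e. split; [exact He|]. intros z Hz. apply Hv, Hy, Hz. }
  assert (Hder : forall t, 0 <= t <= 1 -> is_derive g t 0).
  { intros t Ht. apply (is_derive_ext_loc (fun _ => g t)); [apply Hloc, Ht|].
    apply @is_derive_const. }
  destruct (MVT_gen g 0 1 (fun _ => 0)) as [c [_ Hc]].
  { rewrite Rmin_left, Rmax_right by lra. intros x Hx. apply Hder. lra. }
  { rewrite Rmin_left, Rmax_right by lra. intros x Hx.
    apply continuity_pt_filterlim. apply (@ex_derive_continuous R_AbsRing R_NormedModule).
    exists 0. apply Hder, Hx. }
  unfold g in Hc.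
  replace (z0 + RtoC 0 * d)%C with z0 in Hc by ring.
  replace (z0 + RtoC 1 * d)%C with (z0 + d)%C in Hc by ring.
  destruct (excluded_middle_informative (vanishes_near f (z0 + d)%C)) as [H|_]; [exact H|].
  destruct (excluded_middle_informative (vanishes_near f z0)) as [_|n]; [lra|contradiction].
Qed.

(** * The exponential and binomial series *)

Lemma Cexp_plus x y : Cexp (x + y)%C = (Cexp x * Cexp y)%C.
Proof.
  destruct x as [a b], y as [c d]. unfold Cexp, Cmult, Cplus, Re, Im. simpl.
  rewrite exp_plus, cos_plus, sin_plus. f_equal; ring.
Qed.

Lemma Cexp_0 : Cexp (RtoC 0) = RtoC 1.
Proof. unfold Cexp, RtoC, Re, Im. simpl. rewrite exp_0, cos_0, sin_0. f_equal; ring. Qed.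

Lemma Cexp_RtoC x : Cexp (RtoC x) = RtoC (exp x).
Proof. unfold Cexp, RtoC, Re, Im. simpl. rewrite cos_0, sin_0. f_equal; ring. Qed.

Lemma Cexp_opp z : (Cexp z * Cexp (- z))%C = RtoC 1.
Proof. rewrite <- Cexp_plus, <- Cexp_0. f_equal. ring. Qed.

Lemma Cmod_Cexp z : Cmod (Cexp z) = exp (Re z).
Proof.
  unfold Cmod, Cexp. simpl.
  replace (exp (Re z) * cos (Im z) * (exp (Re z) * cos (Im z) * 1) +
    exp (Re z) * sin (Im z) * (exp (Re z) * sin (Im z) * 1)) with
    (Rsqr (exp (Re z)) * (Rsqr (sin (Im z)) + Rsqr (cos (Im z)))) by (unfold Rsqr; ring).
  rewrite sin2_cos2, Rmult_1_r. apply sqrt_Rsqr. left. apply exp_pos.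
Qed.

Lemma csums_is_series_Re a l : csums a l -> is_series (fun n => Re (a n)) (Re l).
Proof.
  intros H. apply (filterlim_ext (fun n => Re (Csum a (S n)))).
  - intros n. rewrite Rsum_sum_n. set (k := S n). clearbody k.
    induction k as [|k IH]; [reflexivity|]. simpl Rsum. rewrite <- IH. reflexivity.
  - apply filterlim_locally. intros eps. apply ctends_shift in H.
    destruct (H eps (cond_pos eps)) as [N HN]. exists N. intros n Hn.
    change (Rabs (Re (Csum a (S n)) - Re l) < eps).
    eapply Rle_lt_trans; [|apply (HN n Hn)]. apply (re_le_Cmod (Csum a (S n) - l)%C).
Qed.

Lemma csums_is_series_Im a l : csums a l -> is_series (fun n => Im (a n)) (Im l).
Proof.
  intros H. apply (csums_scal (- Ci)%C) in H. apply csums_is_series_Re in H.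
  replace (Im l) with (Re (- Ci * l)%C) by (destruct l; unfold Re, Im; simpl; ring).
  eapply is_series_ext; [|exact H]. intros n. change (Re (- Ci * a n)%C = Im (a n)).
  destruct (a n). unfold Re, Im; simpl; ring.
Qed.

Lemma Rsum_le_is_series (a : nat -> R) l n : (forall i, 0 <= a i) -> is_series a l -> Rsum a n <= l.
Proof.
  intros Ha Hl. apply Rle_trans with (Rsum a (S n)).
  - apply Rsum_monotone; auto.
  - rewrite <- Rsum_sum_n. apply (is_lim_seq_incr_compare (sum_n a)).
    + exact Hl.
    + intros k. rewrite !Rsum_sum_n. simpl. specialize (Ha (S k)). lra.
Qed.

Lemma CV_radius_bounded_partial_sums (a : nat -> R) (m : nat -> R) q B u :
  0 < q -> (forall i, Rabs (a i) <= m i) -> (forall n, Rsum (fun i => m i * q ^ i) n <= B) ->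
  Rabs u < q -> Rbar_lt (Rabs u) (CV_radius a).
Proof.
  intros Hq Ha HB Hu. apply Rbar_lt_le_trans with q; [exact Hu|].
  apply (proj1 (CV_radius_bounded a)). exists B. intros n.
  eapply Rle_trans; [|apply (HB (S n))].
  apply Rle_trans with (m n * q ^ n).
  - rewrite Rabs_mult, <- RPow_abs, (Rabs_pos_eq q) by lra.
    apply Rmult_le_compat_r; [apply pow_le; lra|apply Ha].
  - apply (Rsum_term_le (fun i => m i * q ^ i)); [|lia]. intros i.
    apply Rmult_le_pos; [|apply pow_le; lra]. eapply Rle_trans; [apply Rabs_pos|apply Ha].
Qed.

(* The real form of [(1 + e u) F'(u) = s F(u)] for [F u = sum (a n + i b n) u^n]:
   only the real part, the imaginary part being an instance of it. *)
Lemma PSeries_first_order_ode (a b : nat -> R) (e sg ta u : R) :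
  (forall n, INR (S n) * a (S n) + e * INR n * a n = sg * a n - ta * b n) ->
  Rbar_lt (Rabs u) (CV_radius a) -> Rbar_lt (Rabs u) (CV_radius b) ->
  (1 + e * u) * PSeries (PS_derive a) u = sg * PSeries a u - ta * PSeries b u.
Proof.
  intros Hc Ha Hb.
  assert (Ha' : Rbar_lt (Rabs u) (CV_radius (PS_derive a))) by (rewrite CV_radius_derive; exact Ha).
  pose proof (CV_radius_inside _ _ Ha) as Ea. pose proof (CV_radius_inside _ _ Hb) as Eb.
  pose proof (CV_radius_inside _ _ Ha') as Ea'.
  replace ((1 + e * u) * PSeries (PS_derive a) u) with
    (PSeries (PS_derive a) u + e * (u * PSeries (PS_derive a) u)) by ring.
  rewrite <- PSeries_incr_1, <- PSeries_scal, <- PSeries_plus.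
  2: exact Ea'.
  2:{ apply ex_pseries_scal; [apply Rmult_comm|]. apply ex_pseries_incr_1, Ea'. }
  replace (sg * PSeries a u - ta * PSeries b u) with (sg * PSeries a u + (- ta) * PSeries b u) by ring.
  rewrite <- !PSeries_scal, <- PSeries_plus.
  2,3: apply ex_pseries_scal; [apply Rmult_comm|assumption].
  apply PSeries_ext. intros n.
  specialize (Hc n). destruct n as [|n].
  - change (INR 1 * a 1%nat + e * 0 = sg * a 0%nat + - ta * b 0%nat). simpl INR in *. lra.
  - change (INR (S (S n)) * a (S (S n)) + e * (INR (S n) * a (S n))
            = sg * a (S n) + - ta * b (S n)). lra.
Qed.

(** The common source of the exponential and the binomial series. The recurrence says that F(u) =
    sum c_j u^j satisfies (1 + e u) F' = s F; as l' = 1 / (1 + e u), the function F(u) exp(-s l(u))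
    has derivative zero and keeps its value 1 at u = 0. Differentiation is along the real segment
    [0, t], separately for real and imaginary parts. *)
Lemma power_series_first_order_ode (c : nat -> C) (s : C) (e q B t : R) (l : R -> R) :
  c 0%nat = RtoC 1 ->
  (forall j, RtoC (INR (S j)) * c (S j) + RtoC e * RtoC (INR j) * c j = s * c j)%C ->
  (forall n, Rsum (fun j => Cmod (c j) * q ^ j) n <= B) ->
  0 <= t < q ->
  l 0 = 0 ->
  (forall u, 0 <= u <= t -> 0 < 1 + e * u /\ is_derive l u (/ (1 + e * u))) ->
  csums (fun j => c j * RtoC t ^ j)%C (Cexp (s * RtoC (l t))).
Proof.
  intros Hc0 Hrec HB Ht Hl0 Hl.
  set (a := fun j => Re (c j)). set (b := fun j => Im (c j)).
  set (sg := Re s). set (ta := Im s).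
  assert (Hra : forall u, 0 <= u <= t -> Rbar_lt (Rabs u) (CV_radius a)).
  { intros u Hu. apply (CV_radius_bounded_partial_sums a (fun j => Cmod (c j)) q B); try lra.
    - intros i. apply re_le_Cmod.
    - exact HB.
    - rewrite Rabs_pos_eq; lra. }
  assert (Hrb : forall u, 0 <= u <= t -> Rbar_lt (Rabs u) (CV_radius b)).
  { intros u Hu. apply (CV_radius_bounded_partial_sums b (fun j => Cmod (c j)) q B); try lra.
    - intros i. eapply Rle_trans; [|apply Rmax_Cmod]. apply Rmax_r.
    - exact HB.
    - rewrite Rabs_pos_eq; lra. }
  assert (Hreca : forall n, INR (S n) * a (S n) + e * INR n * a n = sg * a n - ta * b n).
  { intros n. specialize (Hrec n). unfold a, b, sg, ta.
    destruct (c (S n)) as [x y], (c n) as [x' y'], s as [x'' y''].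
    apply (f_equal Re) in Hrec. unfold Cplus, Cmult, RtoC, Re, Im in *.
    cbn [fst snd] in *. lra. }
  assert (Hrecb : forall n, INR (S n) * b (S n) + e * INR n * b n = sg * b n - - ta * a n).
  { intros n. specialize (Hrec n). unfold a, b, sg, ta.
    destruct (c (S n)) as [x y], (c n) as [x' y'], s as [x'' y''].
    apply (f_equal Im) in Hrec. unfold Cplus, Cmult, RtoC, Re, Im in *.
    cbn [fst snd] in *. lra. }
  set (U := PSeries a). set (V := PSeries b).
  (* [p] and [q'] are the real and imaginary parts of exp(-s l(u)), so that the two functions in
     [Hder] are those of F(u) exp(-s l(u)). *)
  set (p := fun u => exp (- sg * l u) * cos (- ta * l u)).
  set (q' := fun u => exp (- sg * l u) * sin (- ta * l u)).
  assert (Hder : forall u, 0 <= u <= t ->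
            is_derive (fun u => U u * p u - V u * q' u) u 0 /\
            is_derive (fun u => U u * q' u + V u * p u) u 0).
  { intros u Hu. destruct (Hl u Hu) as [Hpos Hlu].
    pose proof (is_derive_PSeries a u (Hra u Hu)) as DU.
    pose proof (is_derive_PSeries b u (Hrb u Hu)) as DV.
    pose proof (PSeries_first_order_ode a b e sg ta u Hreca (Hra u Hu) (Hrb u Hu)) as OU.
    pose proof (PSeries_first_order_ode b a e sg (- ta) u Hrecb (Hrb u Hu) (Hra u Hu)) as OV.
    fold U V in OU, OV, DU, DV. set (U' := PSeries (PS_derive a) u) in *.
    set (V' := PSeries (PS_derive b) u) in *.
    assert (EU : U' = / (1 + e * u) * (sg * U u - ta * V u)) by (rewrite <- OU; field; lra).
    assert (EV : V' = / (1 + e * u) * (sg * V u - - ta * U u)) by (rewrite <- OV; field; lra).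
    clearbody U V U' V'. clear OU OV.
    assert (XU : ex_derive U u) by (exists U'; exact DU).
    assert (XV : ex_derive V u) by (exists V'; exact DV).
    assert (Xl : ex_derive l u) by (exists (/ (1 + e * u)); exact Hlu).
    assert (RU : Derive (fun x => U x) u = U') by (apply is_derive_unique, DU).
    assert (RV : Derive (fun x => V x) u = V') by (apply is_derive_unique, DV).
    assert (Rl : Derive (fun x => l x) u = / (1 + e * u)) by (apply is_derive_unique, Hlu).
    unfold p, q'. split; auto_derive; try (repeat split; assumption);
      rewrite RU, RV, Rl, EU, EV; ring. }
  assert (Hconst : forall f : R -> R, (forall u, 0 <= u <= t -> is_derive f u 0) -> f t = f 0).
  { intros f Hf. destruct (MVT_gen f 0 t (fun _ => 0)) as [x [_ Hx]].
    - rewrite Rmin_left, Rmax_right by lra. intros x Hx. apply Hf. lra.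
    - rewrite Rmin_left, Rmax_right by lra. intros x Hx.
      apply continuity_pt_filterlim. apply (@ex_derive_continuous R_AbsRing R_NormedModule).
      exists 0. apply Hf, Hx.
    - lra. }
  pose proof (Hconst _ (fun u Hu => proj1 (Hder u Hu))) as E1.
  pose proof (Hconst _ (fun u Hu => proj2 (Hder u Hu))) as E2.
  cbv beta in E1, E2.
  assert (U0 : U 0 = 1) by (unfold U; rewrite PSeries_0; unfold a; rewrite Hc0; reflexivity).
  assert (V0 : V 0 = 0) by (unfold V; rewrite PSeries_0; unfold b; rewrite Hc0; reflexivity).
  assert (p0 : p 0 = 1) by (unfold p; rewrite Hl0, !Rmult_0_r, exp_0, cos_0; ring).
  assert (q0 : q' 0 = 0) by (unfold q'; rewrite Hl0, !Rmult_0_r, exp_0, sin_0; ring).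
  rewrite U0, V0, p0, q0 in E1, E2.
  assert (EF : ((U t, V t) * Cexp (- (s * RtoC (l t))) = RtoC 1)%C).
  { replace (Cexp (- (s * RtoC (l t))))%C with (p t, q' t).
    - unfold Cmult, RtoC. simpl. f_equal; lra.
    - unfold Cexp, p, q', sg, ta. destruct s as [x y]. unfold Re, Im. simpl.
      f_equal; f_equal; f_equal; ring. }
  destruct (csums_absolute (fun j => c j * RtoC t ^ j)%C (fun j => Cmod (c j) * q ^ j) B)
    as [F HF].
  { intros n. rewrite Cmod_mult, Cmod_pow, Cmod_R, Rabs_pos_eq by lra.
    apply Rmult_le_compat_l; [apply Cmod_ge_0|]. apply pow_incr. lra. }
  { exact HB. }
  assert (HFUV : F = (U t, V t)).
  { apply injective_projections; symmetry; apply is_series_unique.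
    - apply csums_is_series_Re in HF. eapply is_series_ext; [|exact HF].
      intros n. cbv beta. rewrite <- RtoC_pow, re_scal_r. reflexivity.
    - apply csums_is_series_Im in HF. eapply is_series_ext; [|exact HF].
      intros n. cbv beta. rewrite <- RtoC_pow, im_scal_r. reflexivity. }
  replace (Cexp (s * RtoC (l t))) with F; [exact HF|].
  rewrite HFUV, <- (Cmult_1_r (U t, V t)), <- (Cexp_opp (- (s * RtoC (l t)))), Cmult_assoc, EF,
    Cmult_1_l.
  f_equal. ring.
Qed.

Lemma Rsum_exp_le x n : 0 <= x -> Rsum (fun i => x ^ i / INR (fact i)) n <= exp x.
Proof.
  intros Hx. apply Rsum_le_is_series.
  - intros i. apply Rdiv_le_0_compat; [apply pow_le, Hx|apply INR_fact_lt_0].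
  - pose proof (proj1 (is_pseries_R _ _ _) (is_exp_Reals x)) as H.
    eapply is_series_ext; [|exact H]. intros i. unfold Rdiv. apply Rmult_comm.
Qed.

Lemma RtoC_INR_fact_neq_0 n : RtoC (INR (fact n)) <> RtoC 0.
Proof. intros E. apply RtoC_inj in E. revert E. apply INR_fact_neq_0. Qed.

Lemma csums_Cexp w : csums (fun j => w ^ j / RtoC (INR (fact j)))%C (Cexp w).
Proof.
  assert (Hm : forall j q, 0 <= q -> Cmod (w ^ j / RtoC (INR (fact j))) * q ^ j
              = (Cmod w * q) ^ j / INR (fact j)).
  { intros j q Hq. rewrite Cmod_div, Cmod_pow, Cmod_R, Rabs_pos_eq, Rpow_mult_distr.
    - field. apply INR_fact_neq_0.
    - left. apply INR_fact_lt_0.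
    - apply RtoC_INR_fact_neq_0. }
  replace (Cexp w) with (Cexp (w * RtoC 1)%C) by (f_equal; ring).
  apply (csums_ext (fun j => w ^ j / RtoC (INR (fact j)) * RtoC 1 ^ j)%C).
  { intros j. rewrite Cpow_1_l. ring. }
  (* The case e = 0, l(u) = u at t = 1, with w as the exponent s; any q > 1 would serve in place of
     2. *)
  apply (power_series_first_order_ode (fun j => w ^ j / RtoC (INR (fact j)))%C w 0 2
           (exp (Cmod w * 2)) 1 (fun u => u)).
  - simpl. field.
  - intros j. change (fact (S j)) with (S j * fact j)%nat. rewrite mult_INR, RtoC_mult, Cpow_S.
    field. split; [apply RtoC_INR_fact_neq_0|].
    intros E. apply RtoC_inj in E. revert E. apply not_0_INR. lia.
  - intros n. rewrite (Rsum_ext _ (fun i => (Cmod w * 2) ^ i / INR (fact i))).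
    + apply Rsum_exp_le. pose proof (Cmod_ge_0 w). lra.
    + intros i _. apply Hm. lra.
  - lra.
  - reflexivity.
  - intros u Hu. split; [lra|]. auto_derive; [trivial|]. field.
Qed.

(** The moduli in the series of exp(-L (z - z0)) sum to exp(r |L|). For L = ln n the bound is
    n^(-(Re z0 - r)), which can be summed over n. *)
Lemma ana_Cexp L z0 r :
  0 < r -> ana (fun z => Cexp (- z * RtoC L))%C z0 r (exp (- Re z0 * L + r * Rabs L)).
Proof.
  intros Hr. split; [exact Hr|].
  exists (fun i => Cexp (- z0 * RtoC L) * ((- RtoC L) ^ i / RtoC (INR (fact i))))%C. split.
  - intros n.
    rewrite (Rsum_ext _ (fun i => exp (- Re z0 * L) * ((r * Rabs L) ^ i / INR (fact i)))).
    + rewrite Rsum_scal, exp_plus. apply Rmult_le_compat_l; [left; apply exp_pos|].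
      apply Rsum_exp_le. apply Rmult_le_pos; [lra|apply Rabs_pos].
    + intros i _. rewrite Cmod_mult, Cmod_Cexp, Cmod_div, Cmod_pow, Cmod_opp, !Cmod_R.
      * rewrite re_scal_r, (Rabs_pos_eq (INR (fact i))), Rpow_mult_distr.
        -- change (Re (- z0)%C) with (- Re z0). unfold Rdiv. ring.
        -- left. apply INR_fact_lt_0.
      * apply RtoC_INR_fact_neq_0.
  - intros z Hz.
    replace (- z * RtoC L)%C with (- z0 * RtoC L + (- RtoC L * (z - z0)))%C by ring.
    rewrite Cexp_plus.
    apply (csums_ext (fun i => Cexp (- z0 * RtoC L) *
             ((- RtoC L * (z - z0)) ^ i / RtoC (INR (fact i))))%C).
    + intros i. rewrite Cpow_mult_l. unfold Cdiv. ring.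
    + apply csums_scal, csums_Cexp.
Qed.

(** [cbin z j] is the binomial coefficient of [-z] over [j]. *)
Fixpoint cbin (z : C) (j : nat) : C :=
  match j with
  | O => RtoC 1
  | S i => (cbin z i * ((- z - RtoC (INR i)) / RtoC (INR (S i))))%C
  end.

(** B (B + 1) ... (B + j - 1) / j!, the coefficients of (1 - x)^(-B). They majorise [cbin z j] for
    [Cmod z < B]. *)
Fixpoint bbin (B : R) (j : nat) : R :=
  match j with O => 1 | S i => bbin B i * ((B + INR i) / INR (S i)) end.

Lemma RtoC_INR_S_neq_0 n : RtoC (INR (S n)) <> RtoC 0.
Proof. intros E. apply RtoC_inj in E. revert E. apply not_0_INR. lia. Qed.

Lemma INR_S_pos n : 0 < INR (S n).
Proof. apply lt_0_INR. lia. Qed.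

Lemma bbin_pos B j : 0 < B -> 0 < bbin B j.
Proof.
  intros HB. induction j as [|j IH]; cbn [bbin]; [lra|].
  apply Rmult_lt_0_compat; [exact IH|]. apply Rdiv_lt_0_compat; [|apply INR_S_pos].
  pose proof (pos_INR j). lra.
Qed.

Lemma ana_cbin z0 r j : 0 < r -> ana (fun z => cbin z j) z0 r (bbin (Cmod z0 + r) j).
Proof.
  intros Hr. induction j as [|j IH]; cbn [cbin]; cbn [bbin].
  - apply (ana_weaken _ _ _ (Cmod 1)); [rewrite Cmod_1; lra|]. apply ana_const, Hr.
  - apply ana_mult; [exact IH|].
    apply (ana_ext (fun z => - / RtoC (INR (S j)) * (z + RtoC (INR j)))%C).
    { intros z _. field. apply RtoC_INR_S_neq_0. }
    apply (ana_weaken _ _ _ (Cmod (- / RtoC (INR (S j))) * ((Cmod z0 + r) + Cmod (RtoC (INR j))))).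
    { pose proof (INR_S_pos j). rewrite Cmod_opp, Cmod_inv, !Cmod_R, !Rabs_pos_eq;
        try lra; try apply pos_INR; try apply RtoC_INR_S_neq_0. }
    apply ana_scal, ana_plus; [apply ana_id, Hr|apply ana_const, Hr].
Qed.

Lemma Cmod_ana_le f z0 r M z : ana f z0 r M -> Cmod (z - z0) < r -> Cmod (f z) <= M.
Proof.
  intros [Hr [a [Ha Hf]]] Hz. apply (csums_Cmod_le _ _ _ _ (Hf z Hz) (fun n => Rle_refl _)).
  intros n. eapply Rle_trans; [|apply (Ha n)]. apply Rsum_le. intros i _.
  rewrite Cmod_mult, Cmod_pow. apply Rmult_le_compat_l; [apply Cmod_ge_0|].
  apply pow_incr. split; [apply Cmod_ge_0|lra].
Qed.

Lemma Cmod_cbin_le z j B : Cmod z < B -> Cmod (cbin z j) <= bbin B j.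
Proof.
  intros Hz. pose proof (Cmod_ge_0 z).
  assert (E : Cmod (RtoC 0) + B = B) by (rewrite Cmod_0; ring). rewrite <- E.
  apply (Cmod_ana_le _ _ _ _ z (ana_cbin 0 B j ltac:(lra))). rewrite Cminus_0_r. exact Hz.
Qed.

Lemma is_lim_seq_inv_INR_S : is_lim_seq (fun n => / INR (S n)) 0.
Proof.
  apply (is_lim_seq_incr_1 (fun n => / INR n)).
  replace (Finite 0) with (Rbar_inv p_infty) by reflexivity.
  apply is_lim_seq_inv; [apply is_lim_seq_INR|discriminate].
Qed.

(** Ratio test: consecutive terms have ratio q (1 + (B - 1) / (n + 1)), which tends to q. *)
Lemma bbin_series_bounded B q : 0 < B -> 0 < q < 1 ->
  exists K, forall n, Rsum (fun j => bbin B j * q ^ j) n <= K.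
Proof.
  intros HB Hq.
  assert (Hp : forall j, 0 < bbin B j * q ^ j).
  { intros j. apply Rmult_lt_0_compat; [apply bbin_pos, HB|apply pow_lt; lra]. }
  assert (H : ex_series (fun j => Rabs (bbin B j * q ^ j))).
  { apply (ex_series_DAlembert _ q); [lra| |].
    - intros n. apply Rgt_not_eq, Hp.
    - apply (is_lim_seq_ext (fun n => q * (1 + (B - 1) * / INR (S n)))).
      + intros n. pose proof (INR_S_pos n). pose proof (bbin_pos B n HB).
        pose proof (pow_lt q n ltac:(lra)). pose proof (pos_INR n).
        rewrite Rabs_pos_eq.
        * cbn [bbin]. rewrite S_INR in *. simpl pow. field. repeat split; lra.
        * left. apply Rdiv_lt_0_compat; apply Hp.
      + replace (Finite q) with (Rbar_mult q (Rbar_plus 1 (Rbar_mult (B - 1) 0))).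
        * apply is_lim_seq_scal_l.
          apply is_lim_seq_plus with (l1 := 1) (l2 := Rbar_mult (B - 1) 0).
          -- apply is_lim_seq_const.
          -- apply is_lim_seq_scal_l, is_lim_seq_inv_INR_S.
          -- simpl. reflexivity.
        * simpl. f_equal. ring. }
  destruct H as [K HK]. exists K. intros n. apply Rsum_le_is_series.
  - intros i. left. apply Hp.
  - eapply is_series_ext; [|exact HK]. intros j. simpl. rewrite Rabs_pos_eq; [reflexivity|].
    left. apply Hp.
Qed.

Lemma binomial_series z x :
  0 <= x < 1 -> csums (fun j => cbin z j * RtoC x ^ j)%C (Rpow_C (1 + x) (- z)%C).
Proof.
  intros Hx. unfold Rpow_C. pose proof (Cmod_ge_0 z).
  (* The case e = 1, l(u) = ln(1 + u) of the differential equation; (x + 1) / 2 is a radius between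
     x and 1 at which the coefficients are summable. *)
  destruct (bbin_series_bounded (Cmod z + 1) ((x + 1) / 2)) as [K HK]; try lra.
  apply (power_series_first_order_ode (cbin z) (- z)%C 1 ((x + 1) / 2) K x (fun u => ln (1 + u))).
  - reflexivity.
  - intros j. cbn [cbin]. field. apply RtoC_INR_S_neq_0.
  - intros n. eapply Rle_trans; [|apply (HK n)]. apply Rsum_le. intros i _.
    apply Rmult_le_compat_r; [apply pow_le; lra|]. apply Cmod_cbin_le. lra.
  - lra.
  - rewrite Rplus_0_r. apply ln_1.
  - intros u Hu. split; [lra|]. auto_derive; [lra|]. field. lra.
Qed.

Definition binrem (J : nat) (x : R) (z : C) : C :=
  (Rpow_C (1 + x) (- z) - Csum (fun j => cbin z j * RtoC x ^ j) (S J))%C.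

Lemma csums_tail a l k : csums a l -> csums (fun n => a (k + n)%nat) (l - Csum a k)%C.
Proof.
  intros H. unfold csums. apply (ctends_ext (fun n => - Csum a k + Csum a (k + n))%C).
  - intros n. rewrite Csum_app. ring.
  - replace (l - Csum a k)%C with (- Csum a k + l)%C by ring.
    apply ctends_plus; [apply ctends_const|]. apply (ctends_sub (fun n => (k + n)%nat)); [lia|exact H].
Qed.

(** The constant does not depend on [x]: comparing x^(J+1+i) with (x / q)^(J+1) q^(J+1+i) extracts
    x^(J+1) from the tail. With x of size 1 / n, this power moves the half-plane of convergence J +
    1 to the left. *)
Lemma ana_binrem J z0 r q : 0 < r -> 0 < q < 1 ->
  exists K, 0 <= K /\ forall x, 0 <= x <= q -> ana (binrem J x) z0 r (K * x ^ S J).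
Proof.
  intros Hr Hq. pose proof (Cmod_ge_0 z0) as Hz0.
  destruct (bbin_series_bounded (Cmod z0 + r) q) as [K HK]; try lra.
  pose proof (pow_lt q (S J) ltac:(lra)) as HqJ.
  assert (Hb : forall j, 0 < bbin (Cmod z0 + r) j) by (intros; apply bbin_pos; lra).
  exists (K / q ^ S J). split.
  { apply Rdiv_le_0_compat; [|assumption]. apply (HK 0%nat). }
  intros x Hx.
  apply (ana_series (fun n z => RtoC x ^ (S J + n) * cbin z (S J + n))%C _ z0 r
           (fun n => x ^ (S J + n) * bbin (Cmod z0 + r) (S J + n))).
  - intros n. replace (x ^ (S J + n)) with (Cmod (RtoC x ^ (S J + n))).
    + apply ana_scal, ana_cbin, Hr.
    + rewrite Cmod_pow, Cmod_R, Rabs_pos_eq by lra. reflexivity.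
  - intros n.
    apply Rle_trans with (Rsum (fun i => x ^ S J / q ^ S J *
        (bbin (Cmod z0 + r) (S J + i) * q ^ (S J + i))) n).
    + apply Rsum_le. intros i _. rewrite !pow_add.
      apply Rle_trans with (x ^ S J * q ^ i * bbin (Cmod z0 + r) (S J + i)).
      * apply Rmult_le_compat_r; [left; apply Hb|].
        apply Rmult_le_compat_l; [apply pow_le; lra|]. apply pow_incr. lra.
      * right. field_simplify_eq; [ring|lra].
    + rewrite Rsum_scal.
      replace (K / q ^ S J * x ^ S J) with (x ^ S J / q ^ S J * K) by (unfold Rdiv; ring).
      apply Rmult_le_compat_l; [apply Rdiv_le_0_compat; [apply pow_le; lra|assumption]|].
      eapply Rle_trans; [|apply (HK (S J + n)%nat)]. rewrite Rsum_app.
      assert (0 <= Rsum (fun j => bbin (Cmod z0 + r) j * q ^ j) (S J)); [|lra].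
      apply Rsum_nonneg. intros i. left. apply Rmult_lt_0_compat; [apply Hb|apply pow_lt; lra].
  - intros z _. unfold binrem.
    apply (csums_ext (fun n => cbin z (S J + n) * RtoC x ^ (S J + n))%C); [intros; ring|].
    apply (csums_tail (fun j => cbin z j * RtoC x ^ j)%C). apply binomial_series. lra.
Qed.

(** * The functional equation *)

Lemma admissible_0 b A : ~ admissible b A 0.
Proof. intros [H _]. lia. Qed.

Lemma digit_0 b n a : (a < b)%nat -> digit b (b * n + a) 0 = a.
Proof.
  intros Ha. unfold digit. change (b ^ 0)%nat with 1%nat. rewrite Nat.div_1_r.
  rewrite Nat.add_comm, Nat.mul_comm, Nat.Div0.mod_add. apply Nat.mod_small, Ha.
Qed.

Lemma digit_S b n a i : (a < b)%nat -> digit b (b * n + a) (S i) = digit b n i.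
Proof.
  intros Ha. unfold digit. rewrite Nat.pow_succ_r', <- Nat.Div0.div_div.
  do 2 f_equal. symmetry. apply (Nat.div_unique _ _ _ a); [exact Ha|reflexivity].
Qed.

Lemma admissible_mul_add b A n a : (1 < b)%nat -> (a < b)%nat -> (0 < n)%nat ->
  admissible b A (b * n + a) <-> In a A /\ admissible b A n.
Proof.
  intros Hb Ha Hn. split.
  - intros [_ H]. split; [|split; [exact Hn|]].
    + rewrite <- (digit_0 b n a Ha). apply H. change (b ^ 0)%nat with 1%nat. nia.
    + intros i Hi. rewrite <- (digit_S b n a i Ha). apply H. rewrite Nat.pow_succ_r'. nia.
  - intros [HaA [_ H]]. split; [nia|]. intros [|i] Hi.
    + rewrite digit_0; assumption.
    + rewrite digit_S by assumption. apply H. rewrite Nat.pow_succ_r' in Hi. nia.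
Qed.

Lemma admissible_small b A a : (1 < b)%nat -> (0 < a < b)%nat -> In a A -> admissible b A a.
Proof.
  intros Hb Ha HA. split; [lia|]. intros [|i] Hi.
  - replace a with (b * 0 + a)%nat by lia. rewrite digit_0 by lia. exact HA.
  - rewrite Nat.pow_succ_r' in Hi. pose proof (Nat.pow_nonzero b i ltac:(lia)). nia.
Qed.

Definition if_admissible (b : nat) (A : list nat) (h : nat -> C) (n : nat) : C :=
  if excluded_middle_informative (admissible b A n) then h n else RtoC 0.

Definition indicator (A : list nat) (a : nat) : R :=
  if in_dec Nat.eq_dec a A then 1 else 0.

Lemma indicator_bounds A a : 0 <= indicator A a <= 1.
Proof. unfold indicator. destruct in_dec; lra. Qed.

Lemma Rsum_indicator (A : list nat) b :
  NoDup A -> (forall a, In a A -> (a < b)%nat) -> Rsum (indicator A) b = INR (length A).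
Proof.
  intros HN. induction HN as [|x A Hx HN IH]; intros H.
  - simpl length. change (INR 0) with 0. induction b as [|b IHb]; [reflexivity|].
    simpl Rsum. rewrite IHb by (intros a []). unfold indicator. destruct in_dec as [[]|_]. ring.
  - simpl length. rewrite S_INR, <- IH by (intros; apply H; right; assumption).
    assert (E : forall n, Rsum (fun a => if Nat.eq_dec a x then 1 else 0) n
                 = if lt_dec x n then 1 else 0).
    { induction n as [|n IHn]; cbn [Rsum].
      - destruct (lt_dec x 0); [lia|reflexivity].
      - rewrite IHn. destruct (Nat.eq_dec n x), (lt_dec x n), (lt_dec x (S n)); try lia; ring. }
    specialize (E b). destruct (lt_dec x b) as [_|n]; [|exfalso; apply n, H; left; reflexivity].
    rewrite <- E, <- Rsum_plus. apply Rsum_ext. intros a _. unfold indicator.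
    destruct (in_dec Nat.eq_dec a (x :: A)) as [i|i], (in_dec Nat.eq_dec a A) as [j|j],
      (Nat.eq_dec a x) as [e|e]; subst; simpl in i; try contradiction; try ring; exfalso; intuition.
Qed.

Lemma Csum_mul f b n : Csum f (b * n) = Csum (fun i => Csum (fun a => f (b * i + a)%nat) b) n.
Proof.
  induction n as [|n IH].
  - rewrite Nat.mul_0_r. reflexivity.
  - rewrite Nat.mul_succ_r, Csum_app, IH. reflexivity.
Qed.

(** The integers are grouped into blocks b n, ..., b n + b - 1. For n >= 1 the admissible members
    are those with n admissible and a in [A]; the block n = 0 holds the one-digit integers and is
    subtracted. *)
Lemma csums_admissible_split b A h l : (1 < b)%nat ->
  csums (if_admissible b A h) l ->
  csums (if_admissible b A (fun n => Csum (fun a => indicator A a * h (b * n + a)%nat)%C b))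
    (l - Csum (if_admissible b A h) b)%C.
Proof.
  intros Hb Hl. set (u := fun n => Csum (fun a => if_admissible b A h (b * n + a)%nat) b).
  assert (Hu : csums u l).
  { unfold csums. apply (ctends_ext (fun n => Csum (if_admissible b A h) (b * n))).
    - intros n. apply Csum_mul.
    - apply (ctends_sub (fun n => (b * n)%nat)); [intros n; nia|exact Hl]. }
  assert (E0 : u 0%nat = Csum (if_admissible b A h) b).
  { unfold u. rewrite Nat.mul_0_r. reflexivity. }
  rewrite <- E0.
  apply (csums_ext (fun n => match n with O => RtoC 0 | S _ => u n end)).
  - intros [|n]; unfold if_admissible at 1.
    + destruct excluded_middle_informative as [H|_]; [|reflexivity].
      exfalso. exact (admissible_0 _ _ H).
    + destruct excluded_middle_informative as [H|H].
      * apply Csum_ext. intros a Ha. unfold if_admissible, indicator.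
        pose proof (admissible_mul_add b A (S n) a Hb Ha ltac:(lia)) as Q.
        destruct excluded_middle_informative as [H'|H'], in_dec as [i|i]; try ring; exfalso; tauto.
      * apply Csum_zero. intros a Ha. unfold if_admissible.
        pose proof (admissible_mul_add b A (S n) a Hb Ha ltac:(lia)) as Q.
        destruct excluded_middle_informative as [H'|H']; [exfalso; tauto|reflexivity].
  - replace l with (u 0%nat + (l - u 0%nat))%C in Hu by ring.
    apply csums_shift in Hu.
    replace (l - u 0%nat)%C with (RtoC 0 + (l - u 0%nat))%C by ring.
    apply (csums_shift (fun n => match n with O => RtoC 0 | S _ => u n end)). exact Hu.
Qed.

Definition real_term (b : nat) (A : list nat) (t : R) (n : nat) : R :=
  if excluded_middle_informative (admissible b A n) then exp (- t * ln (INR n)) else 0.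

Lemma real_term_nonneg b A t n : 0 <= real_term b A t n.
Proof. unfold real_term. destruct excluded_middle_informative; [left; apply exp_pos|lra]. Qed.

Lemma restricted_term_RtoC b A t n : restricted_term b A (RtoC t) n = RtoC (real_term b A t n).
Proof.
  unfold restricted_term, real_term. destruct excluded_middle_informative; [|reflexivity].
  unfold Rpow_C. rewrite <- RtoC_opp, <- RtoC_mult. apply Cexp_RtoC.
Qed.

(** The source of the majorants for the error series: at a real point the terms are non-negative, so
    the partial sums stay below the value of [K]. *)
Lemma Rsum_real_term_le b A K t n :
  is_meromorphic_continuation b A K -> abscissa b A < t -> Rsum (real_term b A t) n <= Re (K (RtoC t)).
Proof.
  intros [_ HK] Ht. apply Rsum_le_is_series; [apply real_term_nonneg|].
  pose proof (proj2 (csums_is_series _ _) (HK (RtoC t) Ht)) as H.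
  apply csums_is_series_Re in H. eapply is_series_ext; [|exact H].
  intros k. cbv beta. rewrite restricted_term_RtoC. reflexivity.
Qed.

Lemma ln_INR_nonneg n : 0 <= ln (INR n).
Proof.
  destruct n as [|n].
  (* [ln] takes the value 0 outside the positive reals, so that n = 0 is no exception. *)
  - unfold ln. destruct (Rlt_dec 0 (INR 0)) as [H|_]; [|lra].
    exfalso. simpl in H. lra.
  - rewrite <- ln_1. apply ln_le; [lra|]. rewrite S_INR. pose proof (pos_INR n). lra.
Qed.

(** What remains of the sum of (b n + a)^(-z) over the digits a, after division by b^(-z), when the
    expansion of (1 + a / (b n))^(-z) is cut after order J. *)
Definition error_term (b : nat) (A : list nat) (J : nat) (z : C) : nat -> C :=
  if_admissible b A (fun n =>
    Cexp (- z * RtoC (ln (INR n))) *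
    Csum (fun a => indicator A a * binrem J (INR a / (INR b * INR n)) z) b)%C.

(** As a <= b - 1 and n >= 1, the variable of the binomial series stays away from its radius of
    convergence 1, uniformly in n and a. *)
Lemma digit_ratio_bounds (b n a : nat) : (1 < b)%nat -> (0 < n)%nat -> (a < b)%nat ->
  0 <= INR a / (INR b * INR n) <= (INR b - 1) / INR b.
Proof.
  intros Hb Hn Ha. apply le_INR in Ha, Hb, Hn. rewrite S_INR in Ha, Hb, Hn. simpl in *.
  pose proof (pos_INR a). split.
  - apply Rdiv_le_0_compat; nra.
  - apply Rmult_le_reg_r with (INR b * INR n); [nra|].
    replace (INR a / (INR b * INR n) * (INR b * INR n)) with (INR a) by (field; lra).
    replace ((INR b - 1) / INR b * (INR b * INR n)) with ((INR b - 1) * INR n) by (field; lra).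
    nra.
Qed.

(** On the disc, n^(-z) contributes n^(-(Re z0 - r)) and each digit a remainder of order n^(-(J+1)),
    because a / (b n) <= 1 / n. The product is n^(-t) with t = Re z0 - r + J + 1, an exponent at
    which the restricted series converges. *)
Lemma ana_error_term b A K J z0 r :
  (1 < b)%nat -> is_meromorphic_continuation b A K -> 0 < r ->
  abscissa b A < Re z0 - r + INR (S J) ->
  exists (M : nat -> R) B,
    (forall n, ana (fun z => error_term b A J z n) z0 r (M n)) /\ forall n, Rsum M n <= B.
Proof.
  intros Hb HK Hr Hz0. set (t := Re z0 - r + INR (S J)) in *.
  pose proof (le_INR _ _ Hb) as Hb'. simpl in Hb'.
  set (q := (INR b - 1) / INR b).
  assert (Hq : 0 < q < 1).
  { unfold q. split; [apply Rdiv_lt_0_compat; lra|].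
    apply Rmult_lt_reg_r with (INR b); [lra|]. unfold Rdiv. rewrite Rmult_assoc, Rinv_l; lra. }
  destruct (ana_binrem J z0 r q Hr Hq) as [B0 [HB0 Hrem]].
  exists (fun n => INR b * B0 * real_term b A t n), (INR b * B0 * Re (K (RtoC t))). split.
  - intros n. unfold error_term, if_admissible, real_term.
    destruct excluded_middle_informative as [Hadm|_].
    2:{ apply (ana_weaken _ _ _ (Cmod 0)); [rewrite Cmod_0; lra|]. apply ana_const, Hr. }
    destruct Hadm as [Hn _]. pose proof (le_INR _ _ Hn) as Hn'. simpl in Hn'.
    pose proof (ln_INR_nonneg n) as Hln.
    apply (ana_weaken _ _ _ (exp (- Re z0 * ln (INR n) + r * Rabs (ln (INR n))) *
             Rsum (fun a => Cmod (indicator A a) * (B0 * (INR a / (INR b * INR n)) ^ S J)) b)).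
    + rewrite Rabs_pos_eq by exact Hln.
      replace (exp (- t * ln (INR n))) with
        (exp (- Re z0 * ln (INR n) + r * ln (INR n)) * (/ INR n) ^ S J).
      2:{ assert (E : forall k, (/ INR n) ^ k = exp (- INR k * ln (INR n))).
          { intros k. induction k as [|k IH].
            - simpl. rewrite Ropp_0, Rmult_0_l, exp_0. reflexivity.
            - rewrite <- tech_pow_Rmult, IH, S_INR.
              replace (- (INR k + 1) * ln (INR n)) with (- ln (INR n) + - INR k * ln (INR n)) by ring.
              rewrite exp_plus, exp_Ropp, exp_ln by lra. reflexivity. }
          rewrite E, <- exp_plus. unfold t. f_equal. ring. }
      rewrite (Rmult_comm (INR b * B0)), Rmult_assoc.
      apply Rmult_le_compat_l; [left; apply exp_pos|].
      pose proof (pow_lt (/ INR n) (S J) ltac:(apply Rinv_0_lt_compat; lra)) as Hp.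
      apply Rle_trans with (Rsum (fun _ => B0 * (/ INR n) ^ S J) b).
      * apply Rsum_le. intros a Ha. rewrite Cmod_R, Rabs_pos_eq by apply indicator_bounds.
        pose proof (indicator_bounds A a).
        pose proof (digit_ratio_bounds b n a Hb Hn Ha) as Hd.
        assert (Hle : INR a / (INR b * INR n) <= / INR n).
        { apply le_INR in Ha. rewrite S_INR in Ha.
          apply Rmult_le_reg_r with (INR b * INR n); [nra|].
          replace (INR a / (INR b * INR n) * (INR b * INR n)) with (INR a) by (field; lra).
          replace (/ INR n * (INR b * INR n)) with (INR b) by (field; lra). lra. }
        pose proof (pow_incr _ _ (S J) (conj (proj1 Hd) Hle)) as Hpi.
        pose proof (pow_le _ (S J) (proj1 Hd)) as Hp0.
        set (X := (INR a / (INR b * INR n)) ^ S J) in *.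
        apply Rle_trans with (1 * (B0 * X)).
        -- apply Rmult_le_compat_r; [apply Rmult_le_pos; assumption|lra].
        -- rewrite Rmult_1_l. apply Rmult_le_compat_l; assumption.
      * right. assert (E : forall x k, Rsum (fun _ => x) k = INR k * x).
        { intros x k. induction k as [|k IH]; [simpl; ring|].
          rewrite S_INR. simpl Rsum. rewrite IH. ring. }
        rewrite E. ring.
    + apply ana_mult; [apply ana_Cexp, Hr|].
      apply ana_Csum; [exact Hr|]. intros a Ha. apply ana_scal, Hrem.
      apply digit_ratio_bounds; assumption.
  - intros n. rewrite Rsum_scal. apply Rmult_le_compat_l; [apply Rmult_le_pos; lra|].
    apply Rsum_real_term_le; assumption.
Qed.

(** The sum is chosen at each point before any analyticity is known, so that a single [E] serves all
    discs. The radius [r] is half the distance to the boundary line, which keeps each disc inside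
    the half-plane. *)
Lemma error_sum_exists b A K J :
  (1 < b)%nat -> is_meromorphic_continuation b A K ->
  exists E : C -> C, forall z0, abscissa b A - INR (S J) < Re z0 ->
    csums (error_term b A J z0) (E z0) /\ exists r M, ana E z0 r M.
Proof.
  intros Hb HK.
  assert (Hex : forall z, exists l, abscissa b A - INR (S J) < Re z -> csums (error_term b A J z) l).
  { intros z. destruct (Rlt_dec (abscissa b A - INR (S J)) (Re z)) as [Hz|Hz].
    - set (r := (Re z - (abscissa b A - INR (S J))) / 2).
      destruct (ana_error_term b A K J z r Hb HK) as [M [B [HM HB]]]; try (unfold r; lra).
      destruct (csums_absolute (error_term b A J z) M B) as [l Hl].
      + intros n. apply (Cmod_ana_le _ _ _ _ z (HM n)).
        replace (z - z)%C with (RtoC 0) by ring. rewrite Cmod_0. unfold r; lra.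
      + exact HB.
      + exists l. auto.
    - exists (RtoC 0). intros H. contradiction. }
  set (E := fun z => proj1_sig (constructive_indefinite_description _ (Hex z))).
  assert (HE : forall z, abscissa b A - INR (S J) < Re z -> csums (error_term b A J z) (E z)).
  { intros z. exact (proj2_sig (constructive_indefinite_description _ (Hex z))). }
  exists E. intros z0 Hz0. split; [apply HE, Hz0|].
  set (r := (Re z0 - (abscissa b A - INR (S J))) / 2).
  destruct (ana_error_term b A K J z0 r Hb HK) as [M [B [HM HB]]]; try (unfold r; lra).
  exists r, B. apply (ana_series (fun n z => error_term b A J z n) E z0 r M B HM HB).
  intros z Hz. apply HE. pose proof (re_le_Cmod (z - z0)%C) as H.
  change (Re (z - z0)%C) with (Re z - Re z0) in H.
  pose proof (Rcomplements.Rabs_le_between' (Re z) (Re z0) (Cmod (z - z0))).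
  destruct (proj1 H0 H). unfold r in Hz. lra.
Qed.

(** The sum g_j. As [pow] gives 0 ^ 0 = 1, the digit 0 is counted in g_0, which equals the number of
    allowed digits. *)
Definition digit_moment (b : nat) (A : list nat) (j : nat) : R :=
  Rsum (fun a => indicator A a * (INR a / INR b) ^ j) b.

Lemma Cexp_ln_mul_add (b n a : nat) z : (1 < b)%nat -> (0 < n)%nat ->
  Cexp (- z * RtoC (ln (INR (b * n + a)))) =
  (Cexp (- z * RtoC (ln (INR b))) * Cexp (- z * RtoC (ln (INR n))) *
   Rpow_C (1 + INR a / (INR b * INR n)) (- z))%C.
Proof.
  intros Hb Hn. apply le_INR in Hb, Hn. simpl in *. pose proof (pos_INR a).
  unfold Rpow_C. rewrite <- !Cexp_plus. f_equal.
  replace (INR (b * n + a)) with (INR b * INR n * (1 + INR a / (INR b * INR n))).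
  - assert (0 <= INR a / (INR b * INR n)) by (apply Rdiv_le_0_compat; nra).
    rewrite !ln_mult, !RtoC_plus by (try apply Rmult_lt_0_compat; lra). ring.
  - rewrite plus_INR, mult_INR. field. lra.
Qed.

Lemma Cexp_ln_pow (n j : nat) z : (0 < n)%nat ->
  Cexp (- (z + RtoC (INR j)) * RtoC (ln (INR n))) =
  (Cexp (- z * RtoC (ln (INR n))) * RtoC (/ INR n) ^ j)%C.
Proof.
  intros Hn. apply le_INR in Hn. simpl in Hn. induction j as [|j IH].
  - simpl. rewrite Cmult_1_r. f_equal. ring.
  - rewrite S_INR, RtoC_plus, Cpow_S.
    replace (- (z + (INR j + 1)) * ln (INR n))%C with
      (- (z + INR j) * ln (INR n) + RtoC (- ln (INR n)))%C by (rewrite RtoC_opp; ring).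
    rewrite Cexp_plus, IH, Cexp_RtoC, exp_Ropp, exp_ln by lra. ring.
Qed.

(** The blocks n >= 1 are expanded to order J, and the finite sum over j is exchanged with the sum
    over n, each K(s + j) being given by a convergent series. The term j = 0 is N b^(-s) K(s) and is
    still on the right-hand side. *)
Lemma functional_equation_half_plane b A K J E s :
  (1 < b)%nat -> is_meromorphic_continuation b A K -> abscissa b A < Re s ->
  csums (error_term b A J s) E ->
  K s = (Csum (restricted_term b A s) b + Cexp (- s * RtoC (ln (INR b))) *
    (Csum (fun j => cbin s j * RtoC (digit_moment b A j) * K (s + RtoC (INR j))) (S J) + E))%C.
Proof.
  intros Hb [_ HK] Hs HE.
  pose proof (proj2 (csums_is_series _ _) (HK s Hs)) as H0.
  set (h := fun n => Cexp (- s * RtoC (ln (INR n)))).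
  change (restricted_term b A s) with (if_admissible b A h) in *.
  apply csums_admissible_split in H0; [|exact Hb].
  set (D := Csum (if_admissible b A h) b) in *.
  assert (H1 : csums (if_admissible b A (fun n => Csum (fun a => indicator A a * h (b * n + a)%nat)%C b))
     (Cexp (- s * RtoC (ln (INR b))) *
    (Csum (fun j => cbin s j * RtoC (digit_moment b A j) * K (s + RtoC (INR j))) (S J) + E))%C).
  { apply (csums_ext (fun n => Cexp (- s * RtoC (ln (INR b))) *
       (Csum (fun j => (cbin s j * RtoC (digit_moment b A j)) *
           restricted_term b A (s + RtoC (INR j)) n) (S J) + error_term b A J s n))%C).
    - intros n. unfold error_term, if_admissible, restricted_term.
      destruct excluded_middle_informative as [[Hn _]|_].
      2:{ rewrite Csum_zero by (intros; ring). ring. }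
      unfold h.
      rewrite (Csum_ext (fun a => indicator A a * Cexp (- s * RtoC (ln (INR (b * n + a)))))%C
        (fun a => Cexp (- s * RtoC (ln (INR b))) * (Cexp (- s * RtoC (ln (INR n))) *
          (Csum (fun j => indicator A a * (cbin s j * RtoC (INR a / (INR b * INR n)) ^ j)) (S J) +
           indicator A a * binrem J (INR a / (INR b * INR n)) s)))%C).
      2:{ intros a _. rewrite Cexp_ln_mul_add by assumption. rewrite Csum_scal.
          unfold binrem. ring. }
      rewrite !Csum_scal, Csum_plus, Csum_swap. f_equal.
      rewrite Cmult_plus_distr_l. f_equal. rewrite <- Csum_scal. apply Csum_ext. intros j _.
      unfold Rpow_C. rewrite Cexp_ln_pow by exact Hn. unfold digit_moment.
      rewrite <- Csum_RtoC.
      replace (cbin s j * Csum (fun i => RtoC (indicator A i * (INR i / INR b) ^ j)) b *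
        (Cexp (- s * RtoC (ln (INR n))) * RtoC (/ INR n) ^ j))%C with
        (Cexp (- s * RtoC (ln (INR n))) * (cbin s j * RtoC (/ INR n) ^ j *
          Csum (fun i => RtoC (indicator A i * (INR i / INR b) ^ j)) b))%C by ring.
      f_equal. rewrite <- Csum_scal. apply Csum_ext. intros a _.
      replace (INR a / (INR b * INR n)) with (INR a / INR b * / INR n).
      + rewrite !RtoC_mult, RtoC_pow, Cpow_mult_l. ring.
      + apply le_INR in Hb, Hn. simpl in Hb, Hn. field. lra.
    - apply csums_scal, csums_plus; [|exact HE].
      apply (csums_Csum (fun j n => cbin s j * RtoC (digit_moment b A j) *
        restricted_term b A (s + RtoC (INR j)) n)%C). intros j _.
      apply csums_scal, csums_is_series, HK.
      change (Re (s + RtoC (INR j))%C) with (Re s + INR j). pose proof (pos_INR j). lra. }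
  pose proof (ctends_unique _ _ _ H0 H1) as Heq. rewrite <- Heq. ring.
Qed.

Lemma ana_restricted_term b A n z0 r : 0 < r -> exists M, ana (fun z => restricted_term b A z n) z0 r M.
Proof.
  intros Hr. unfold restricted_term. destruct excluded_middle_informative.
  - eexists. apply ana_Cexp, Hr.
  - eexists. apply ana_const, Hr.
Qed.

(** The difference of the two sides is locally meromorphic along the horizontal segment that joins
    [z0] to the half-plane of convergence. The discs are punctured because [K z] or some [K (z + j)]
    may have a pole at the centre. *)
Lemma functional_equation_near b A K J :
  (1 < b)%nat -> is_meromorphic_continuation b A K ->
  exists E : C -> C, forall z0, abscissa b A - INR (S J) < Re z0 ->
    (exists r M, ana E z0 r M) /\
    exists rho, 0 < rho /\ forall z, 0 < Cmod (z - z0) < rho ->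
      K z = (Csum (restricted_term b A z) b + Cexp (- z * RtoC (ln (INR b))) *
        (Csum (fun j => cbin z j * RtoC (digit_moment b A j) * K (z + RtoC (INR j))) (S J) + E z))%C.
Proof.
  intros Hb HK. destruct (error_sum_exists b A K J Hb HK) as [E HE].
  exists E. intros z0 Hz0. split; [apply HE, Hz0|].
  set (G := fun z => (Csum (restricted_term b A z) b + Cexp (- z * RtoC (ln (INR b))) *
        (Csum (fun j => cbin z j * RtoC (digit_moment b A j) * K (z + RtoC (INR j))) (S J) + E z))%C).
  set (F := fun z => (K z + (- RtoC 1) * G z)%C).
  assert (Hmero : forall z, abscissa b A - INR (S J) < Re z -> mero_at F z).
  { intros z Hz. unfold F, G. destruct HK as [HK HK'].
    apply mero_at_plus; [apply mero_at_meromorphic, HK|].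
    apply mero_at_mult; [apply mero_at_const|]. apply mero_at_plus.
    - apply mero_at_Csum with (f := fun i z => restricted_term b A z i). intros i _.
      destruct (ana_restricted_term b A i z 1 Rlt_0_1) as [M HM]. eapply mero_at_ana, HM.
    - apply mero_at_mult; [eapply mero_at_ana, (ana_Cexp _ z 1 Rlt_0_1)|].
      apply mero_at_plus.
      + apply mero_at_Csum with
          (f := fun j z => (cbin z j * RtoC (digit_moment b A j) * K (z + RtoC (INR j)))%C).
        intros j _. apply mero_at_mult; [apply mero_at_mult|].
        * eapply mero_at_ana, (ana_cbin z 1 j Rlt_0_1).
        * apply mero_at_const.
        * apply mero_at_translate, mero_at_meromorphic, HK.
      + destruct (HE z Hz) as [_ [r [M HM]]]. eapply mero_at_ana, HM. }
  (* The real part of z0 + d is at least s_0 + 1, so the unit disc about that point lies in the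
     half-plane of convergence. *)
  set (d := Rabs (Re z0 - abscissa b A) + 1).
  assert (Hd : 1 <= d) by (unfold d; pose proof (Rabs_pos (Re z0 - abscissa b A)); lra).
  assert (Hd2 : abscissa b A + 1 <= Re z0 + d).
  { unfold d. pose proof (Rle_abs (- (Re z0 - abscissa b A))). rewrite Rabs_Ropp in H. lra. }
  assert (Hv : vanishes_near F (z0 + RtoC d)%C).
  { exists 1. split; [lra|]. intros z Hz.
    assert (Hre : abscissa b A < Re z).
    { pose proof (re_le_Cmod (z - (z0 + RtoC d))%C) as H.
      change (Re (z - (z0 + RtoC d))%C) with (Re z - (Re z0 + d)) in H.
      pose proof (Rle_abs (- (Re z - (Re z0 + d)))) as H'. rewrite Rabs_Ropp in H'. lra. }
    pose proof (pos_INR (S J)).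
    unfold F, G. rewrite <- (functional_equation_half_plane b A K J (E z) z); try assumption.
    - ring.
    - apply HE. lra. }
  apply (identity_along_segment F (z0 + RtoC d)%C (- RtoC d)%C) in Hv.
  - replace (z0 + RtoC d + - RtoC d)%C with z0 in Hv by ring.
    destruct Hv as [rho [Hrho Hv]]. exists rho. split; [exact Hrho|]. intros z Hz.
    specialize (Hv z Hz). change (K z = G z). unfold F in Hv.
    replace (K z) with (K z + - (1) * G z + G z)%C by ring. rewrite Hv. ring.
  - intros t Ht. apply Hmero.
    replace (z0 + RtoC d + RtoC t * - RtoC d)%C with (z0 + RtoC (d - t * d))%C
      by (rewrite RtoC_minus, RtoC_mult; ring).
    change (Re (z0 + RtoC (d - t * d))%C) with (Re z0 + (d - t * d)). nra.
Qed.

(** * Residues *)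

Definition plim (f : C -> C) (z0 l : C) : Prop :=
  forall eps, 0 < eps -> exists d, 0 < d /\
    forall z, 0 < Cmod (z - z0) < d -> Cmod (f z - l) < eps.

Lemma plim_ext_near f g z0 l rho :
  0 < rho -> (forall z, 0 < Cmod (z - z0) < rho -> f z = g z) -> plim f z0 l -> plim g z0 l.
Proof.
  intros Hr E H eps He. destruct (H eps He) as [d [Hd Hf]]. exists (Rmin d rho). split.
  - apply Rmin_glb_lt; assumption.
  - intros z Hz. pose proof (Rmin_l d rho). pose proof (Rmin_r d rho).
    rewrite <- E by lra. apply Hf. lra.
Qed.

Lemma plim_ext f g z0 l : (forall z, f z = g z) -> plim f z0 l -> plim g z0 l.
Proof. intros E. apply (plim_ext_near f g z0 l 1 Rlt_0_1). auto. Qed.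

Lemma plim_const c z0 : plim (fun _ => c) z0 c.
Proof.
  intros eps He. exists 1. split; [lra|]. intros z _.
  replace (c - c)%C with (RtoC 0) by ring. rewrite Cmod_0. exact He.
Qed.

Lemma plim_plus f g z0 l m : plim f z0 l -> plim g z0 m -> plim (fun z => f z + g z)%C z0 (l + m)%C.
Proof.
  intros Hf Hg eps He. destruct (Hf (eps / 2)) as [d [Hd Hf']]; [lra|].
  destruct (Hg (eps / 2)) as [e [He' Hg']]; [lra|]. exists (Rmin d e). split.
  - apply Rmin_glb_lt; assumption.
  - intros z Hz. pose proof (Rmin_l d e). pose proof (Rmin_r d e).
    specialize (Hf' z ltac:(lra)). specialize (Hg' z ltac:(lra)).
    replace (f z + g z - (l + m))%C with ((f z - l) + (g z - m))%C by ring.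
    eapply Rle_lt_trans; [apply Cmod_triangle|]. lra.
Qed.

Lemma plim_mult f g z0 l m : plim f z0 l -> plim g z0 m -> plim (fun z => f z * g z)%C z0 (l * m)%C.
Proof.
  intros Hf Hg eps He. pose proof (Cmod_ge_0 l) as Hl. pose proof (Cmod_ge_0 m) as Hm.
  set (e := Rmin 1 (eps / (Cmod l + Cmod m + 1))).
  assert (Hq : 0 < eps / (Cmod l + Cmod m + 1)) by (apply Rdiv_lt_0_compat; lra).
  assert (He1 : 0 < e) by (apply Rmin_glb_lt; lra).
  assert (He2 : e <= 1) by apply Rmin_l.
  assert (He3 : e * (Cmod l + Cmod m + 1) <= eps).
  { apply Rle_trans with (eps / (Cmod l + Cmod m + 1) * (Cmod l + Cmod m + 1)).
    - apply Rmult_le_compat_r; [lra|apply Rmin_r].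
    - right. field. lra. }
  destruct (Hf e He1) as [d1 [Hd1 Hf']]. destruct (Hg e He1) as [d2 [Hd2 Hg']].
  exists (Rmin d1 d2). split; [apply Rmin_glb_lt; assumption|].
  intros z Hz. pose proof (Rmin_l d1 d2). pose proof (Rmin_r d1 d2).
  specialize (Hf' z ltac:(lra)). specialize (Hg' z ltac:(lra)).
  replace (f z * g z - l * m)%C with ((f z - l) * (g z - m) + (l * (g z - m) + m * (f z - l)))%C by ring.
  pose proof (Cmod_ge_0 (f z - l)). pose proof (Cmod_ge_0 (g z - m)).
  eapply Rle_lt_trans; [apply Cmod_triangle|].
  eapply Rle_lt_trans; [apply Rplus_le_compat_l, Cmod_triangle|].
  rewrite !Cmod_mult. nra.
Qed.

Lemma plim_Csum (f : nat -> C -> C) (l : nat -> C) z0 n :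
  (forall i, (i < n)%nat -> plim (f i) z0 (l i)) ->
  plim (fun z => Csum (fun i => f i z) n) z0 (Csum l n).
Proof.
  induction n as [|n IH]; intros H; simpl.
  - apply plim_const.
  - apply plim_plus; auto.
Qed.

Lemma plim_inv f z0 l : l <> RtoC 0 -> plim f z0 l -> plim (fun z => / f z)%C z0 (/ l)%C.
Proof.
  intros Hl Hf eps He. pose proof (proj1 (Cmod_gt_0 l) Hl) as Hl'.
  (* The first bound keeps |f z| above |l| / 2; the second then makes |f z - l| / (|f z| |l|) less
     than eps. *)
  set (e := Rmin (Cmod l / 2) (eps * Cmod l * Cmod l / 2)).
  assert (He1 : 0 < e) by (apply Rmin_glb_lt; [lra|]; repeat apply Rmult_lt_0_compat; lra).
  destruct (Hf e He1) as [d [Hd Hf']]. exists d. split; [exact Hd|].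
  intros z Hz. specialize (Hf' z Hz).
  assert (H1 : Cmod (f z - l) < Cmod l / 2) by (eapply Rlt_le_trans; [exact Hf'|apply Rmin_l]).
  assert (H2 : Cmod (f z - l) < eps * Cmod l * Cmod l / 2)
    by (eapply Rlt_le_trans; [exact Hf'|apply Rmin_r]).
  pose proof (Cmod_triangle_minus l (f z) 0) as H3. rewrite !Cminus_0_r, (Cmod_minus_sym l) in H3.
  assert (Hfz : f z <> RtoC 0) by (apply Cmod_gt_0; lra).
  replace (/ f z - / l)%C with (- (f z - l) * / (f z * l))%C by (field; split; assumption).
  rewrite Cmod_mult, Cmod_opp, Cmod_inv, Cmod_mult by (apply Cmult_neq_0; assumption).
  apply Rmult_lt_reg_r with (Cmod (f z) * Cmod l); [apply Rmult_lt_0_compat; lra|].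
  rewrite Rmult_assoc, Rinv_l, Rmult_1_r by (apply Rgt_not_eq, Rmult_lt_0_compat; lra).
  eapply Rlt_le_trans; [exact H2|].
  apply Rle_trans with (eps * (Cmod l / 2 * Cmod l)); [lra|].
  apply Rmult_le_compat_l; [lra|]. apply Rmult_le_compat_r; lra.
Qed.

Lemma plim_unique f z0 l m : plim f z0 l -> plim f z0 m -> l = m.
Proof.
  intros Hl Hm. apply Cmod_le_0_eq. intros eps He.
  destruct (Hl (eps / 2)) as [d [Hd H1]]; [lra|]. destruct (Hm (eps / 2)) as [e [He' H2]]; [lra|].
  assert (0 < Rmin d e) by (apply Rmin_glb_lt; assumption).
  pose proof (Rmin_l d e). pose proof (Rmin_r d e).
  set (z := (z0 + RtoC (Rmin d e / 2))%C).
  assert (Ez : Cmod (z - z0) = Rmin d e / 2).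
  { unfold z. replace (z0 + RtoC (Rmin d e / 2) - z0)%C with (RtoC (Rmin d e / 2)) by ring.
    rewrite Cmod_R, Rabs_pos_eq; lra. }
  specialize (H1 z ltac:(lra)). specialize (H2 z ltac:(lra)).
  pose proof (Cmod_triangle_minus l (f z) m) as Htri. rewrite (Cmod_minus_sym l (f z)) in Htri. lra.
Qed.

Lemma plim_ana f z0 r M : ana f z0 r M -> plim f z0 (f z0).
Proof.
  intros H eps He. pose proof (ana_M_nonneg _ _ _ _ H) as HM.
  assert (Hr : 0 < r) by apply H.
  exists (Rmin r (eps * r / (M + 1))). split.
  - apply Rmin_glb_lt; [assumption|]. apply Rdiv_lt_0_compat; [apply Rmult_lt_0_compat; lra|lra].
  - intros z Hz. pose proof (Rmin_l r (eps * r / (M + 1))).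
    assert (H1 : Cmod (z - z0) < eps * r / (M + 1)) by (eapply Rlt_le_trans; [apply Hz|apply Rmin_r]).
    eapply Rle_lt_trans; [apply (ana_lipschitz _ _ _ _ _ H); lra|].
    apply Rmult_lt_compat_r with (r := M + 1) in H1; [|lra].
    replace (eps * r / (M + 1) * (M + 1)) with (eps * r) in H1 by (field; lra).
    apply Rmult_lt_reg_r with r; [assumption|].
    replace (Cmod (z - z0) / r * M * r) with (Cmod (z - z0) * M) by (field; lra). nra.
Qed.

Lemma plim_minus_center z0 : plim (fun z => z - z0)%C z0 (RtoC 0).
Proof. intros eps He. exists eps. split; [exact He|]. intros z Hz. rewrite Cminus_0_r. lra. Qed.

Lemma plim_translate f z0 c l : plim f (z0 + c)%C l -> plim (fun z => f (z + c)%C) z0 l.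
Proof.
  intros H eps He. destruct (H eps He) as [d [Hd Hf]]. exists d. split; [exact Hd|].
  intros z Hz. apply Hf. replace (z + c - (z0 + c))%C with (z - z0)%C by ring. exact Hz.
Qed.

(** The residue at a point where the pole is at most simple; [R = 0] stands for a removable
    singularity. *)
Definition residue_limit (K : C -> C) (z0 R : C) : Prop := plim (fun z => (z - z0) * K z)%C z0 R.

(** At a pole of order p, g(z) = (z - z0)^(p-1) ((z - z0) K(z)), so a zero limit would force g(z0) =
    0. At a point of analyticity the limit is 0. *)
Lemma pole_iff_residue_limit K z0 R : meromorphic K -> residue_limit K z0 R ->
  pole K z0 <-> R <> RtoC 0.
Proof.
  intros HK HR. split.
  - intros [p [Hp [g [r [Hg [Hg0 [Hr E]]]]]]] HR0. apply Hg0.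
    destruct (analytic_at_ana _ _ Hg) as [r' [M HM]].
    apply (plim_unique g z0); [apply (plim_ana _ _ _ _ HM)|].
    destruct p as [|p]; [lia|].
    apply (plim_ext_near (fun z => (z - z0) ^ p * ((z - z0) * K z))%C _ _ _ r Hr).
    + intros z Hz. rewrite E by exact Hz. rewrite Cpow_S. field.
      assert (z - z0 <> 0)%C by (apply Cmod_gt_0; lra). split; [apply Cpow_nz|]; assumption.
    + clear E. assert (Hpow : exists l, plim (fun z => (z - z0) ^ p)%C z0 l).
      { clear. induction p as [|p [l IH]].
        - exists (RtoC 1). apply (plim_ext (fun _ => RtoC 1)); [reflexivity|apply plim_const].
        - exists (RtoC 0 * l)%C. apply (plim_ext (fun z => (z - z0) * (z - z0) ^ p)%C).
          + intros z. rewrite Cpow_S. reflexivity.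
          + apply plim_mult; [apply plim_minus_center|exact IH]. }
      destruct Hpow as [l Hl]. replace (RtoC 0) with (l * R)%C by (rewrite HR0; ring).
      apply plim_mult; assumption.
  - intros HR0. destruct (HK z0) as [Ha|Hp]; [|exact Hp]. exfalso. apply HR0.
    destruct (analytic_at_ana _ _ Ha) as [r' [M HM]].
    apply (plim_unique _ z0 _ _ HR). replace (RtoC 0) with (RtoC 0 * K z0)%C by ring.
    apply plim_mult; [apply plim_minus_center|apply (plim_ana _ _ _ _ HM)].
Qed.

(** At s_(0,k) the factor 1 - N b^(-z) equals 1 - exp(-(z - z0) ln b), hence has a simple zero with
    derivative ln b. The limit follows from |exp(w) - 1 - w| <= e |w|^2 for |w| < 1. *)
Lemma plim_Cexp_difference_quotient L z0 :
  plim (fun z => (1 - Cexp (- (z - z0) * RtoC L)) / (z - z0))%C z0 (RtoC L).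
Proof.
  assert (Hquad : forall w, Cmod w < 1 -> Cmod (Cexp w - (1 + w)) <= Cmod w * Cmod w * exp 1).
  { intros w Hw.
    pose proof (power_series_remainder (fun j => / RtoC (INR (fact j)))%C 0 1 (exp 1) w (Cexp w) 2)
      as P. rewrite Cminus_0_r in P.
    replace (Cexp w - (1 + w))%C with
      (Cexp w - Csum (fun i => / RtoC (INR (fact i)) * w ^ i)%C 2)%C.
    2:{ simpl. field. }
    replace (Cmod w * Cmod w) with ((Cmod w / 1) ^ 2) by field.
    apply P; [lra| |exact Hw|].
    - intros n. eapply Rle_trans; [|apply (Rsum_exp_le 1 n); lra]. apply Rsum_le. intros i _.
      rewrite Cmod_inv, Cmod_R, Rabs_pos_eq by
        (first [left; apply INR_fact_lt_0 | apply RtoC_INR_fact_neq_0]).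
      right. unfold Rdiv. ring.
    - apply (csums_ext (fun j => w ^ j / RtoC (INR (fact j)))%C); [|apply csums_Cexp].
      intros j. unfold Cdiv. ring. }
  intros eps He. pose proof (Rabs_pos L) as HL. pose proof (exp_pos 1) as He1.
  set (X := Rabs L * Rabs L * exp 1 + 1).
  assert (HX : 0 < X) by (unfold X; assert (0 <= Rabs L * Rabs L) by nra; nra).
  exists (Rmin (/ (Rabs L + 1)) (eps / X)). split.
  { apply Rmin_glb_lt; [apply Rinv_0_lt_compat; lra|apply Rdiv_lt_0_compat; assumption]. }
  intros z Hz. set (w := (z - z0)%C) in *.
  assert (H1 : Cmod w < / (Rabs L + 1)) by (eapply Rlt_le_trans; [apply Hz|apply Rmin_l]).
  assert (H2 : Cmod w < eps / X) by (eapply Rlt_le_trans; [apply Hz|apply Rmin_r]).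
  apply Rmult_lt_compat_r with (r := Rabs L + 1) in H1; [|lra].
  rewrite Rinv_l in H1 by lra.
  apply Rmult_lt_compat_r with (r := X) in H2; [|assumption].
  unfold Rdiv in H2. rewrite Rmult_assoc, Rinv_l, Rmult_1_r in H2 by lra.
  assert (Hw : w <> RtoC 0) by (apply Cmod_gt_0; lra).
  assert (HwL : Cmod (- w * RtoC L) = Cmod w * Rabs L) by (rewrite Cmod_mult, Cmod_opp, Cmod_R; ring).
  specialize (Hquad (- w * RtoC L)%C). rewrite HwL in Hquad.
  replace ((1 - Cexp (- w * L)) / w - L)%C with (- (Cexp (- w * L) - (1 + - w * L)) * / w)%C
    by (field; exact Hw).
  rewrite Cmod_mult, Cmod_opp, Cmod_inv by exact Hw.
  apply Rmult_lt_reg_r with (Cmod w); [lra|].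
  rewrite Rmult_assoc, Rinv_l, Rmult_1_r by lra.
  eapply Rle_lt_trans; [apply Hquad; nra|]. unfold X in H2. nra.
Qed.

(** * The candidate poles and the recursion for the residues *)

Lemma abscissa_mul_ln b A : (1 < b)%nat -> abscissa b A * ln (INR b) = ln (INR (length A)).
Proof.
  intros Hb. unfold abscissa. field. apply Rgt_not_eq. rewrite <- ln_1.
  apply ln_increasing; [lra|]. apply (lt_INR 1) in Hb. simpl in Hb. lra.
Qed.

Lemma ln_INR_pos b : (1 < b)%nat -> 0 < ln (INR b).
Proof.
  intros Hb. rewrite <- ln_1. apply ln_increasing; [lra|]. apply (lt_INR 1) in Hb. simpl in Hb. lra.
Qed.

Lemma Cexp_2PI_Z k : Cexp (- (RtoC (IZR k) * (RtoC 2 * RtoC PI * Ci)))%C = RtoC 1.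
Proof.
  replace (- (RtoC (IZR k) * (RtoC 2 * RtoC PI * Ci)))%C with
    (RtoC 0 + RtoC (- (2 * IZR k * PI)) * Ci)%C.
  2:{ rewrite RtoC_opp, !RtoC_mult. ring. }
  set (y := IZR k * PI).
  replace (Cexp _) with (cos (2 * - y), sin (2 * - y)).
  - assert (Hs : sin (- y) = 0) by (rewrite sin_neg, (sin_eq_0_1 y); [ring|exists k; reflexivity]).
    rewrite cos_2a_sin, sin_2a, Hs. unfold RtoC. f_equal; ring.
  - unfold Cexp, RtoC, Ci, Cplus, Cmult, Re, Im, y. simpl.
    replace (0 + (- (2 * IZR k * PI) * 0 - 0 * 1)) with 0 by ring.
    rewrite exp_0, !Rmult_1_l. f_equal; f_equal; ring.
Qed.

Lemma digit_moment_0 b A : NoDup A -> (forall a, In a A -> (a < b)%nat) ->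
  digit_moment b A 0 = INR (length A).
Proof.
  intros HN HA. rewrite <- (Rsum_indicator A b HN HA). apply Rsum_ext. intros a _.
  simpl. ring.
Qed.

Lemma candidate_pole_shift b A m k :
  candidate_pole b A m k = (candidate_pole b A 0 k - RtoC (INR m))%C.
Proof. unfold candidate_pole. simpl INR. ring. Qed.

Lemma Re_candidate_pole b A m k : (1 < b)%nat -> Re (candidate_pole b A m k) = abscissa b A - INR m.
Proof.
  intros Hb. pose proof (ln_INR_pos b Hb).
  unfold candidate_pole, Cdiv. rewrite <- RtoC_inv by lra.
  unfold Ci, Re, RtoC, Cplus, Cminus, Cmult, Copp. simpl. field. lra.
Qed.

Lemma Im_candidate_pole b A m k : (1 < b)%nat ->
  Im (candidate_pole b A m k) = IZR k * (2 * PI / ln (INR b)).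
Proof.
  intros Hb. pose proof (ln_INR_pos b Hb).
  unfold candidate_pole, Cdiv. rewrite <- RtoC_inv by lra.
  unfold Ci, Im, RtoC, Cplus, Cminus, Cmult, Copp. simpl. field. lra.
Qed.

(** The value does not depend on [k]: at s_(m,k) the factor 1 - N b^(-s) is 1 - b^m, which vanishes
    for m = 0 only. *)
Lemma Cexp_candidate_pole b A m k : (1 < b)%nat -> (0 < length A)%nat ->
  Cexp (- candidate_pole b A m k * RtoC (ln (INR b)))%C = RtoC (INR b ^ m / INR (length A)).
Proof.
  intros Hb HA. pose proof (ln_INR_pos b Hb) as HL. apply (lt_INR 0) in HA. simpl in HA.
  assert (HL' : RtoC (ln (INR b)) <> RtoC 0) by (intros E; apply RtoC_inj in E; lra).
  replace (- candidate_pole b A m k * RtoC (ln (INR b)))%C with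
    (RtoC (- ln (INR (length A)) + INR m * ln (INR b)) +
      - (RtoC (IZR k) * (RtoC 2 * RtoC PI * Ci)))%C.
  - rewrite Cexp_plus, Cexp_2PI_Z, Cmult_1_r, Cexp_RtoC. f_equal.
    rewrite exp_plus, exp_Ropp, exp_ln by exact HA.
    assert (E : exp (INR m * ln (INR b)) = INR b ^ m).
    { rewrite <- Rpower_pow; [reflexivity|]. apply (lt_INR 1) in Hb. simpl in Hb. lra. }
    rewrite E. unfold Rdiv. ring.
  - rewrite RtoC_plus, RtoC_opp, RtoC_mult, <- (abscissa_mul_ln b A Hb), RtoC_mult.
    unfold candidate_pole. field. exact HL'.
Qed.

(** The term j = 0 has moved to the left. All further use of [H] is through its limit at [z0]. *)
Lemma reduced_functional_equation b A K J :
  (1 < b)%nat -> NoDup A -> (forall a, In a A -> (a < b)%nat) ->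
  is_meromorphic_continuation b A K ->
  forall z0, abscissa b A - INR (S J) < Re z0 ->
  exists (H : C -> C) l rho, plim H z0 l /\ 0 < rho /\ forall z, 0 < Cmod (z - z0) < rho ->
    ((1 - RtoC (INR (length A)) * Cexp (- z * RtoC (ln (INR b)))) * K z =
     Cexp (- z * RtoC (ln (INR b))) *
      Csum (fun j => cbin z (S j) * RtoC (digit_moment b A (S j)) * K (z + RtoC (INR (S j)))) J
     + H z)%C.
Proof.
  intros Hb HN HA HK z0 Hz0.
  destruct (functional_equation_near b A K J Hb HK) as [E HE].
  destruct (HE z0 Hz0) as [[r [M HM]] [rho [Hrho Heq]]].
  exists (fun z => Csum (restricted_term b A z) b + Cexp (- z * RtoC (ln (INR b))) * E z)%C.
  eexists. exists rho. split; [|split; [exact Hrho|]].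
  - apply plim_plus.
    + apply (plim_Csum (fun i z => restricted_term b A z i) (fun i => restricted_term b A z0 i)).
      intros i _. destruct (ana_restricted_term b A i z0 1 Rlt_0_1) as [M' HM'].
      exact (plim_ana _ _ _ _ HM').
    + apply plim_mult; [exact (plim_ana _ _ _ _ (ana_Cexp _ z0 1 Rlt_0_1))|].
      exact (plim_ana _ _ _ _ HM).
  - intros z Hz. specialize (Heq z Hz). rewrite Csum_shift in Heq.
    rewrite digit_moment_0 in Heq by assumption. cbn [cbin] in Heq.
    replace (z + RtoC (INR 0))%C with z in Heq by (simpl; ring).
    transitivity (K z - RtoC (INR (length A)) * Cexp (- z * RtoC (ln (INR b))) * K z)%C; [ring|].
    rewrite Heq at 1. cbn [cbin]. ring.
Qed.

(** For J = 0 the equation is (1 - N b^(-z)) K(z) = H(z), and dividing by the simple zero gives the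
    residue l / ln b. *)
Lemma residue_limit_exists b A K z0 :
  (1 < b)%nat -> NoDup A -> (forall a, In a A -> (a < b)%nat) ->
  is_meromorphic_continuation b A K -> abscissa b A - 1 < Re z0 ->
  (RtoC (INR (length A)) * Cexp (- z0 * RtoC (ln (INR b))) = RtoC 1)%C ->
  exists R, residue_limit K z0 R.
Proof.
  intros Hb HN HA HK Hz0 H1. pose proof (ln_INR_pos b Hb) as HL.
  destruct (reduced_functional_equation b A K 0 Hb HN HA HK z0) as [H [l [rho [Hl [Hrho E]]]]].
  { simpl. lra. }
  set (L := ln (INR b)) in *.
  exists (l * / RtoC L)%C.
  assert (HL0 : RtoC L <> RtoC 0) by (intros E0; apply RtoC_inj in E0; lra).
  pose proof (plim_Cexp_difference_quotient L z0) as HQ.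
  (* Within distance L of its limit L, the difference quotient is non-zero and can be inverted. *)
  destruct (HQ L HL) as [d [Hd Hq]].
  apply (plim_ext_near (fun z => H z * / ((1 - Cexp (- (z - z0) * RtoC L)) / (z - z0)))%C
            _ _ _ (Rmin d rho)).
  - apply Rmin_glb_lt; assumption.
  - intros z Hz. pose proof (Rmin_l d rho). pose proof (Rmin_r d rho).
    specialize (E z ltac:(lra)). specialize (Hq z ltac:(lra)). simpl Csum in E.
    replace (RtoC (INR (length A)) * Cexp (- z * RtoC L))%C with (Cexp (- (z - z0) * RtoC L)) in E.
    2:{ replace (- z * RtoC L)%C with (- z0 * RtoC L + - (z - z0) * RtoC L)%C by ring.
        rewrite Cexp_plus, Cmult_assoc, H1. ring. }
    replace (H z) with ((1 - Cexp (- (z - z0) * RtoC L)) * K z)%C by (rewrite E; ring).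
    assert (Hw : (z - z0)%C <> RtoC 0) by (apply Cmod_gt_0; lra).
    field. split; [exact Hw|]. intros E0. rewrite E0 in Hq.
    replace (0 / (z - z0) - L)%C with (- RtoC L)%C in Hq by (field; exact Hw).
    rewrite Cmod_opp, Cmod_R, Rabs_pos_eq in Hq; lra.
  - apply plim_mult; [exact Hl|]. apply plim_inv; assumption.
Qed.

(** The equation is multiplied by z - z0 = (z + j) - (z0 + j): each K(z + j) then yields the residue
    at z0 + j, and H yields 0. *)
Lemma residue_limit_step b A K J z0 (Rs : nat -> C) :
  (1 < b)%nat -> NoDup A -> (forall a, In a A -> (a < b)%nat) ->
  is_meromorphic_continuation b A K -> abscissa b A - INR (S J) < Re z0 ->
  (1 - RtoC (INR (length A)) * Cexp (- z0 * RtoC (ln (INR b))))%C <> RtoC 0 ->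
  (forall j, (j < J)%nat -> residue_limit K (z0 + RtoC (INR (S j)))%C (Rs j)) ->
  residue_limit K z0
    (/ (1 - RtoC (INR (length A)) * Cexp (- z0 * RtoC (ln (INR b)))) *
     (Cexp (- z0 * RtoC (ln (INR b))) *
      Csum (fun j => cbin z0 (S j) * RtoC (digit_moment b A (S j)) * Rs j) J))%C.
Proof.
  intros Hb HN HA HK Hz0 Hne HR.
  destruct (reduced_functional_equation b A K J Hb HN HA HK z0 Hz0)
    as [H [l [rho [Hl [Hrho E]]]]].
  set (L := ln (INR b)) in *. set (N := RtoC (INR (length A))) in *.
  assert (Hexp : plim (fun z => Cexp (- z * RtoC L))%C z0 (Cexp (- z0 * RtoC L))%C)
    by exact (plim_ana _ _ _ _ (ana_Cexp L z0 1 Rlt_0_1)).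
  assert (Hden : plim (fun z => 1 - N * Cexp (- z * RtoC L))%C z0 (1 - N * Cexp (- z0 * RtoC L))%C).
  { apply plim_plus; [apply plim_const|].
    apply (plim_ext (fun z => - N * Cexp (- z * RtoC L))%C); [intros; ring|].
    replace (- (N * Cexp (- z0 * L)))%C with (- N * Cexp (- z0 * L))%C by ring.
    apply plim_mult; [apply plim_const|exact Hexp]. }
  destruct (Hden _ (proj1 (Cmod_gt_0 _) Hne)) as [d [Hd Hd']].
  apply (plim_ext_near (fun z => / (1 - N * Cexp (- z * RtoC L)) *
    (Cexp (- z * RtoC L) * Csum (fun j => cbin z (S j) * RtoC (digit_moment b A (S j)) *
        (((z + RtoC (INR (S j))) - (z0 + RtoC (INR (S j)))) * K (z + RtoC (INR (S j))))) J
      + (z - z0) * H z))%C _ _ _ (Rmin d rho)).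
  - apply Rmin_glb_lt; assumption.
  - intros z Hz. pose proof (Rmin_l d rho). pose proof (Rmin_r d rho).
    specialize (E z ltac:(lra)). specialize (Hd' z ltac:(lra)).
    assert (Hnz : (1 - N * Cexp (- z * RtoC L))%C <> RtoC 0).
    { intros E0. rewrite E0 in Hd'. rewrite Cmod_minus_sym, Cminus_0_r in Hd'. lra. }
    replace (H z) with ((1 - N * Cexp (- z * RtoC L)) * K z - Cexp (- z * RtoC L) *
      Csum (fun j => cbin z (S j) * RtoC (digit_moment b A (S j)) * K (z + RtoC (INR (S j)))) J)%C
      by (rewrite E; ring).
    rewrite (Csum_ext _ (fun j => (z - z0) *
       (cbin z (S j) * RtoC (digit_moment b A (S j)) * K (z + RtoC (INR (S j)))))%C)
      by (intros; ring).
    rewrite Csum_scal. field. exact Hnz.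
  - apply plim_mult; [apply plim_inv; assumption|].
    match goal with |- plim _ _ ?X => replace X with (X + RtoC 0 * l)%C by ring end.
    apply plim_plus; [|apply plim_mult; [apply plim_minus_center|exact Hl]].
    apply plim_mult; [exact Hexp|].
    apply plim_Csum with (f := fun j z => (cbin z (S j) * RtoC (digit_moment b A (S j)) *
        (((z + RtoC (INR (S j))) - (z0 + RtoC (INR (S j)))) * K (z + RtoC (INR (S j)))))%C).
    intros j Hj. apply plim_mult; [apply plim_mult; [|apply plim_const]|].
    + exact (plim_ana _ _ _ _ (ana_cbin z0 1 (S j) Rlt_0_1)).
    + apply (plim_translate (fun z => (z - (z0 + RtoC (INR (S j)))) * K z)%C). apply HR, Hj.
Qed.

(** [(1 - s) (2 - s) ... (m - s)], the factor of the residue at [s - m] that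
    depends on the line of poles. *)
Fixpoint rising (s : C) (m : nat) : C :=
  match m with O => RtoC 1 | S i => (rising s i * (RtoC (INR (S i)) - s))%C end.

(** j! binom(m - s, j) = (m - s) (m - 1 - s) ... (m - j + 1 - s) is the product of the last j
    factors of [rising s m]. *)
Lemma cbin_mul_rising s m j : (j <= m)%nat ->
  (cbin (s - RtoC (INR m)) j * rising s (m - j) = rising s m / RtoC (INR (fact j)))%C.
Proof.
  induction j as [|j IH]; intros Hj.
  - rewrite Nat.sub_0_r. simpl. field.
  - specialize (IH ltac:(lia)). cbn [cbin].
    replace (m - j)%nat with (S (m - S j)) in IH by lia. cbn [rising] in IH.
    change (fact (S j)) with (S j * fact j)%nat. rewrite mult_INR, RtoC_mult.
    replace (RtoC (INR (S (m - S j)))) with (RtoC (INR m) - RtoC (INR j))%C in IH.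
    2:{ rewrite <- RtoC_minus, <- minus_INR by lia. do 2 f_equal. lia. }
    transitivity (rising s m / INR (fact j) / RtoC (INR (S j)))%C.
    + rewrite <- IH. field. apply RtoC_INR_S_neq_0.
    + field. split; [apply RtoC_INR_fact_neq_0|apply RtoC_INR_S_neq_0].
Qed.

(** The constant [c] is fixed before [k], so it is common to all lines of poles. *)
Definition residue_ratio (b : nat) (A : list nat) (K : C -> C) (m : nat) (c : C) : Prop :=
  forall k R0, residue_limit K (candidate_pole b A 0 k) R0 ->
    residue_limit K (candidate_pole b A m k)
      (rising (candidate_pole b A 0 k) m * c * R0)%C.

(* Dividing the residue at s_{m,k} by [rising s_{0,k} m] makes the recursion
   given by the functional equation independent of [k]. *)
Lemma residue_ratio_exists b A K :
  (1 < b)%nat -> NoDup A -> (forall a, In a A -> (a < b)%nat) -> (0 < length A)%nat ->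
  is_meromorphic_continuation b A K ->
  forall m, exists c, residue_ratio b A K m c.
Proof.
  intros Hb HN HA Hlen HK.
  assert (H : forall n, exists c : nat -> C, forall m, (m < n)%nat -> residue_ratio b A K m (c m)).
  2:{ intros m. destruct (H (S m)) as [c Hc]. exists (c m). apply Hc. lia. }
  induction n as [|n [c Hc]].
  - exists (fun _ => RtoC 0). intros m Hm. lia.
  - assert (Hn : exists x, residue_ratio b A K n x).
    2:{ destruct Hn as [x Hx]. exists (fun m => if Nat.eq_dec m n then x else c m).
        intros m Hm. destruct (Nat.eq_dec m n) as [->|Hne]; [exact Hx|]. apply Hc. lia. }
    destruct n as [|n].
    { exists (RtoC 1). intros k R0 HR. simpl.
      replace (1 * 1 * R0)%C with R0 by ring. exact HR. }
    set (N := RtoC (INR (length A))). set (beta := RtoC (INR b ^ S n / INR (length A))).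
    assert (HNb : (1 - N * beta)%C <> RtoC 0).
    { unfold N, beta. rewrite <- RtoC_mult, <- RtoC_minus. intros E. apply RtoC_inj in E.
      apply (lt_INR 0) in Hlen. apply (lt_INR 1) in Hb. simpl in Hlen, Hb.
      replace (INR (length A) * (INR b ^ S n / INR (length A))) with (INR b ^ S n) in E
        by (field; lra).
      pose proof (Rlt_pow_R1 (INR b) (S n) Hb ltac:(lia)). lra. }
    (* The recursion c_m = b^m / (N (1 - b^m)) times the sum over 1 <= j <= m of g_j c_(m-j) / j!,
       for m = [S n]; the summation index is shifted by one. *)
    exists (/ (1 - N * beta) * (beta * Csum (fun j => / RtoC (INR (fact (S j))) *
              RtoC (digit_moment b A (S j)) * c (n - j)%nat) (S n)))%C.
    intros k R0 HR. set (s := candidate_pole b A 0 k) in *.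
    pose proof (residue_limit_step b A K (S n) (candidate_pole b A (S n) k)
      (fun j => rising s (n - j) * c (n - j)%nat * R0)%C Hb HN HA HK) as Hstep.
    rewrite (Cexp_candidate_pole b A (S n) k Hb Hlen) in Hstep. fold N beta in Hstep.
    replace (rising s (S n) * (/ (1 - N * beta) * (beta * Csum (fun j => / RtoC (INR (fact (S j))) *
              RtoC (digit_moment b A (S j)) * c (n - j)%nat) (S n))) * R0)%C with
      (/ (1 - N * beta) * (beta * Csum (fun j => cbin (candidate_pole b A (S n) k) (S j) *
        RtoC (digit_moment b A (S j)) * (rising s (n - j) * c (n - j)%nat * R0)) (S n)))%C.
    + apply Hstep; [|exact HNb|].
      * rewrite Re_candidate_pole by exact Hb. rewrite (S_INR (S n)). lra.
      * intros j Hj. replace (candidate_pole b A (S n) k + RtoC (INR (S j)))%C with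
          (candidate_pole b A (n - j) k).
        -- apply Hc; [lia|exact HR].
        -- rewrite (candidate_pole_shift _ _ (n - j)), (candidate_pole_shift _ _ (S n)).
           replace (S n) with ((n - j) + S j)%nat by lia. rewrite plus_INR, RtoC_plus. ring.
    + rewrite (Csum_ext _ (fun j => (rising s (S n) * R0) * (/ RtoC (INR (fact (S j))) *
              RtoC (digit_moment b A (S j)) * c (n - j)%nat))%C).
      * rewrite Csum_scal. ring.
      * intros j Hj. pose proof (cbin_mul_rising s (S n) (S j) ltac:(lia)) as Q.
        rewrite (candidate_pole_shift b A (S n)). fold s.
        change (S n - S j)%nat with (n - j)%nat in Q.
        transitivity ((cbin (s - INR (S n)) (S j) * rising s (n - j)) *
          RtoC (digit_moment b A (S j)) * c (n - j)%nat * R0)%C; [ring|].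
        rewrite Q. unfold Cdiv. ring.
Qed.

(** * The pole at the abscissa and the case of all digits *)

Lemma Rsum_mul f b n : Rsum f (b * n) = Rsum (fun i => Rsum (fun a => f (b * i + a)%nat) b) n.
Proof.
  induction n as [|n IH].
  - rewrite Nat.mul_0_r. reflexivity.
  - rewrite Nat.mul_succ_r, Rsum_app, IH. reflexivity.
Qed.

(** For t >= 0 the terms (n + 1)^(-t) lie below n^(-t) and, unlike these, are comparable from below
    with the terms of the block of b n + a. *)
Definition shifted_term (b : nat) (A : list nat) (t : R) (n : nat) : R :=
  if excluded_middle_informative (admissible b A n) then exp (- t * ln (INR (S n))) else 0.

Lemma shifted_term_nonneg b A t n : 0 <= shifted_term b A t n.
Proof. unfold shifted_term. destruct excluded_middle_informative; [left; apply exp_pos|lra]. Qed.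

Lemma shifted_term_le b A t n : 0 <= t -> shifted_term b A t n <= real_term b A t n.
Proof.
  intros Ht. unfold shifted_term, real_term.
  destruct excluded_middle_informative as [[Hn _]|_]; [|lra].
  apply (lt_INR 0) in Hn. simpl in Hn.
  assert (ln (INR n) <= ln (INR (S n))) by (apply ln_le; [assumption|rewrite S_INR; lra]).
  destruct (Req_dec (- t * ln (INR (S n))) (- t * ln (INR n))) as [->|Hne]; [lra|].
  left. apply exp_increasing. nra.
Qed.

Lemma exp_le_compat x y : x <= y -> exp x <= exp y.
Proof. intros [H| ->]; [left; apply exp_increasing, H|lra]. Qed.

(* [b n + a + 1 <= b (n + 1)], hence the lower bound. *)
Lemma shifted_term_block b A t n : (1 < b)%nat -> NoDup A -> (forall a, In a A -> (a < b)%nat) ->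
  0 <= t ->
  exp (- t * ln (INR b)) * INR (length A) * shifted_term b A t n <=
  Rsum (fun a => shifted_term b A t (b * n + a)) b.
Proof.
  intros Hb HN HA Ht. rewrite <- (Rsum_indicator A b HN HA).
  rewrite Rmult_assoc, (Rmult_comm (Rsum _ _)), <- Rmult_assoc, <- Rsum_scal.
  apply Rsum_le. intros a Ha. unfold shifted_term at 1.
  destruct excluded_middle_informative as [Hn|_].
  2:{ rewrite Rmult_0_r, Rmult_0_l. apply shifted_term_nonneg. }
  unfold indicator. destruct in_dec as [Hi|_].
  2:{ rewrite Rmult_0_r. apply shifted_term_nonneg. }
  unfold shifted_term. destruct excluded_middle_informative as [_|Hc].
  - rewrite Rmult_1_r, <- exp_plus. apply exp_le_compat.
    assert (Hb' : 0 < INR b) by (apply (lt_INR 0); lia).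
    assert (ln (INR (S (b * n + a))) <= ln (INR b) + ln (INR (S n))).
    { rewrite <- ln_mult by (try exact Hb'; apply INR_S_pos). rewrite <- mult_INR.
      apply ln_le; [apply INR_S_pos|]. apply le_INR. nia. }
    nra.
  - exfalso. apply Hc. apply admissible_mul_add; [exact Hb|exact Ha|apply Hn|tauto].
Qed.

(** Let l be the sum of the shifted terms, x = b^(-t) and y = N b^(-t) = b^(-(t - s_0)). The block n
    = 0 contributes at least x, owing to a non-zero digit a with a + 1 <= b, and the others at least
    y l. Hence l >= x + y l, so x <= (1 - y) l, where l <= K(t) and 1 - y <= (t - s_0) ln b. *)
Lemma Re_continuation_lower_bound b A K t :
  (1 < b)%nat -> NoDup A -> (forall a, In a A -> (a < b)%nat) ->
  (exists a, In a A /\ a <> 0%nat) ->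
  is_meromorphic_continuation b A K -> 0 <= abscissa b A < t ->
  exp (- t * ln (INR b)) <= (t - abscissa b A) * ln (INR b) * Re (K (RtoC t)).
Proof.
  intros Hb HN HA [a0 [Ha0 Ha0']] HK Ht. pose proof (ln_INR_pos b Hb) as HL.
  set (x := exp (- t * ln (INR b))). set (kappa := Re (K (RtoC t))).
  set (f := shifted_term b A t). set (y := x * INR (length A)).
  assert (Hlen : 0 < INR (length A)).
  { apply (lt_INR 0). destruct A as [|a1 A']; [destruct Ha0|simpl; lia]. }
  assert (Hy : y = exp (- ((t - abscissa b A) * ln (INR b)))).
  { unfold y, x. rewrite <- (exp_ln (INR (length A)) Hlen), <- exp_plus, <- (abscissa_mul_ln b A Hb).
    f_equal. ring. }
  assert (Hx : 0 < x) by apply exp_pos.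
  assert (Hy0 : 0 < y) by (rewrite Hy; apply exp_pos).
  assert (Hy1 : 1 - y <= (t - abscissa b A) * ln (INR b)).
  { rewrite Hy. pose proof (exp_ineq1_le (- ((t - abscissa b A) * ln (INR b)))). lra. }
  assert (Hy2 : y <= 1).
  { rewrite Hy, <- exp_0. apply exp_le_compat. nra. }
  assert (Hk : forall n, Rsum f n <= kappa).
  { intros n. eapply Rle_trans; [|apply (Rsum_real_term_le b A K t n HK); lra].
    apply Rsum_le. intros i _. apply shifted_term_le. lra. }
  assert (Hrec : forall n, x + y * Rsum f n <= Rsum f (b * S n)).
  { intros n. rewrite Rsum_mul, Rsum_shift. apply Rplus_le_compat.
    - apply Rle_trans with (f a0).
      + unfold f, shifted_term. pose proof (HA a0 Ha0) as Hlt.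
        destruct excluded_middle_informative as [_|Hc].
        * apply exp_le_compat. assert (ln (INR (S a0)) <= ln (INR b)).
          { apply ln_le; [apply INR_S_pos|apply le_INR; lia]. }
          nra.
        * exfalso. apply Hc. apply admissible_small; [exact Hb|lia|exact Ha0].
      + rewrite Nat.mul_0_r. apply (Rsum_term_le f); [apply shifted_term_nonneg|apply HA, Ha0].
    - rewrite <- Rsum_scal.
      apply Rle_trans with (Rsum (fun i => y * f i) (S n)).
      { apply Rsum_monotone; [|lia]. intros i. apply Rmult_le_pos; [lra|apply shifted_term_nonneg]. }
      rewrite Rsum_shift. replace (y * f 0%nat) with 0.
      + rewrite Rplus_0_l. apply Rsum_le. intros i _.
        apply shifted_term_block; try assumption. lra.
      + unfold f, shifted_term. destruct excluded_middle_informative as [Hc|_]; [|ring].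
        exfalso. exact (admissible_0 _ _ Hc). }
  destruct (completeness (fun v => exists n, v = Rsum f n)) as [l [Hub Hlub]].
  { exists kappa. intros v [n ->]. apply Hk. }
  { exists (Rsum f 0), 0%nat. reflexivity. }
  assert (Hlk : l <= kappa) by (apply Hlub; intros v [n ->]; apply Hk).
  assert (Hl : l <= (l - x) / y).
  { apply Hlub. intros v [n ->]. specialize (Hrec n).
    pose proof (Hub _ (ex_intro _ (b * S n)%nat eq_refl)).
    apply Rmult_le_reg_r with y; [exact Hy0|].
    replace ((l - x) / y * y) with (l - x) by (field; lra). lra. }
  assert (Hl' : x <= (1 - y) * l).
  { apply Rmult_le_compat_r with (r := y) in Hl; [|lra].
    replace ((l - x) / y * y) with (l - x) in Hl by (field; lra). lra. }
  assert (Hk0 : 0 <= kappa) by (apply (Hk 0%nat)).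
  apply Rle_trans with ((1 - y) * kappa); [nra|]. apply Rmult_le_compat_r; assumption.
Qed.

(** Among the factors i - s_0 with i >= 1, only 1 - s_0 can vanish, and only when all digits are
    allowed. *)
Lemma abscissa_bounds b A : (1 < b)%nat -> NoDup A -> (forall a, In a A -> (a < b)%nat) ->
  (0 < length A)%nat -> 0 <= abscissa b A <= 1 /\ (abscissa b A = 1 -> length A = b) /\
  (length A = b -> abscissa b A = 1).
Proof.
  intros Hb HN HA Hlen. pose proof (ln_INR_pos b Hb) as HL.
  pose proof (abscissa_mul_ln b A Hb) as E. pose proof (ln_INR_nonneg (length A)) as H0.
  assert (Hle : (length A <= b)%nat).
  { rewrite <- (length_seq b 0). apply NoDup_incl_length; [exact HN|].
    intros a Ha. apply in_seq. specialize (HA a Ha). lia. }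
  assert (Hlen' : 0 < INR (length A)) by (apply (lt_INR 0), Hlen).
  assert (H1 : ln (INR (length A)) <= ln (INR b)) by (apply ln_le; [assumption|apply le_INR, Hle]).
  split; [nra|]. split.
  - intros E1. rewrite E1, Rmult_1_l in E. apply INR_eq, ln_inv; [assumption| |congruence].
    apply (lt_INR 0). lia.
  - intros E1. rewrite E1 in E. apply Rmult_eq_reg_r with (ln (INR b)); lra.
Qed.

(** For 0 < t <= 1 the real number t Re K(s_0 + t) is at least b^(-(s_0 + t)) / ln b, hence at least
    b^(-(s_0 + 1)) / ln b, the [eps] below; it cannot tend to 0. *)
Lemma residue_at_abscissa_neq_0 b A K R0 :
  (1 < b)%nat -> NoDup A -> (forall a, In a A -> (a < b)%nat) ->
  (exists a, In a A /\ a <> 0%nat) -> (0 < length A)%nat ->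
  is_meromorphic_continuation b A K ->
  residue_limit K (RtoC (abscissa b A)) R0 -> R0 <> RtoC 0.
Proof.
  intros Hb HN HA Hex Hlen HK HR E. subst R0.
  pose proof (ln_INR_pos b Hb) as HL. destruct (abscissa_bounds b A Hb HN HA Hlen) as [Ha _].
  set (al := abscissa b A) in *. set (L := ln (INR b)) in *.
  set (eps := exp (- (al + 1) * L) / L).
  destruct (HR eps) as [d [Hd H]]; [apply Rdiv_lt_0_compat; [apply exp_pos|exact HL]|].
  set (t := Rmin 1 (d / 2)).
  assert (Ht : 0 < t) by (apply Rmin_glb_lt; lra).
  assert (Ht1 : t <= 1) by apply Rmin_l. assert (Ht2 : t <= d / 2) by apply Rmin_r.
  assert (Et : (RtoC (al + t) - RtoC al)%C = RtoC t) by (rewrite RtoC_plus; ring).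
  specialize (H (RtoC (al + t))). rewrite Et, Cmod_R, Rabs_pos_eq, Cminus_0_r in H by lra.
  specialize (H ltac:(lra)).
  pose proof (Re_continuation_lower_bound b A K (al + t) Hb HN HA Hex HK ltac:(fold al; lra)) as Q.
  fold al L in Q. replace (al + t - al) with t in Q by ring.
  pose proof (re_le_Cmod (RtoC t * K (RtoC (al + t)))%C) as P. rewrite re_scal_l in P.
  pose proof (Rle_abs (t * Re (K (RtoC (al + t))))) as P'.
  assert (exp (- (al + 1) * L) <= exp (- (al + t) * L)) by (apply exp_le_compat; nra).
  assert (H3 : t * Re (K (RtoC (al + t))) < eps) by lra.
  apply Rmult_lt_compat_r with (r := L) in H3; [|exact HL].
  unfold eps in H3. replace (exp (- (al + 1) * L) / L * L) with (exp (- (al + 1) * L)) in H3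
    by (field; lra). lra.
Qed.

(** * All digits allowed: change of base and independence of logarithms *)

Lemma full_digits b A : NoDup A -> length A = b -> (forall a, In a A -> (a < b)%nat) ->
  forall a, (a < b)%nat -> In a A.
Proof.
  intros HN Hlen HA a Ha. assert (H : incl (seq 0 b) A).
  { apply NoDup_length_incl; [exact HN|rewrite length_seq; lia|].
    intros c Hc. apply in_seq. specialize (HA c Hc). lia. }
  apply H, in_seq. lia.
Qed.

Lemma admissible_full b A n : (1 < b)%nat -> (forall a, (a < b)%nat -> In a A) ->
  admissible b A n <-> (0 < n)%nat.
Proof.
  intros Hb HA. split; [intros [H _]; exact H|]. intros Hn. split; [exact Hn|].
  intros i _. apply HA. apply Nat.mod_upper_bound. lia.
Qed.

(* With all digits allowed, the series is the Riemann zeta function, for every base. *)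
Lemma full_digits_change_base b A b' K :
  (1 < b)%nat -> (1 < b')%nat -> NoDup A -> length A = b -> (forall a, In a A -> (a < b)%nat) ->
  is_meromorphic_continuation b A K -> is_meromorphic_continuation b' (seq 0 b') K.
Proof.
  intros Hb Hb' HN Hlen HA [HK HS]. split; [exact HK|]. intros s Hs.
  assert (E : forall n, restricted_term b A s n = restricted_term b' (seq 0 b') s n).
  { intros n. unfold restricted_term.
    pose proof (admissible_full b A n Hb (full_digits b A HN Hlen HA)) as H1.
    pose proof (admissible_full b' (seq 0 b') n Hb' ltac:(intros; apply in_seq; lia)) as H2.
    destruct excluded_middle_informative, excluded_middle_informative; tauto || reflexivity. }
  eapply is_series_ext; [exact E|]. apply HS.
  unfold abscissa in *. rewrite length_seq in Hs. rewrite Hlen.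
  pose proof (ln_INR_pos b Hb). pose proof (ln_INR_pos b' Hb').
  unfold Rdiv in *. rewrite Rinv_r in * by lra. exact Hs.
Qed.

(** Powers of b + 1 are congruent to 1 modulo b, while b^m is divisible by b for m >= 1; the case m
    = 0 is settled by size. *)
Lemma pow_S_base_neq b n m : (1 < b)%nat -> (0 < n)%nat -> (S b ^ n <> b ^ m)%nat.
Proof.
  intros Hb Hn E.
  assert (H : forall k, exists q, (S b ^ k = b * q + 1)%nat).
  { induction k as [|k [q IH]]; [exists 0%nat; simpl; lia|].
    exists (b * q + q + 1)%nat. rewrite Nat.pow_succ_r', IH. nia. }
  destruct m as [|m].
  - change (b ^ 0)%nat with 1%nat in E. pose proof (Nat.pow_gt_1 (S b) n ltac:(lia) ltac:(lia)). lia.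
  - destruct (H n) as [q Hq]. rewrite Nat.pow_succ_r' in E.
    assert (F : (b * (b ^ m) = b * q + 1)%nat) by lia.
    assert ((b * (b ^ m - q) = 1)%nat) by (rewrite Nat.mul_sub_distr_l; lia).
    apply Nat.eq_mul_1 in H0. lia.
Qed.

(** Taking absolute values makes the exponents natural numbers, and the relation becomes (b + 1)^|k|
    = b^|q|. *)
Lemma ln_S_base_independent b (k q : Z) : (1 < b)%nat ->
  IZR k * ln (INR (S b)) = IZR q * ln (INR b) -> k = 0%Z.
Proof.
  intros Hb E. destruct (Z.eq_dec k 0) as [|Hk]; [assumption|]. exfalso.
  pose proof (ln_INR_pos b Hb) as H1. pose proof (ln_INR_pos (S b) ltac:(lia)) as H2.
  apply (f_equal Rabs) in E. rewrite !Rabs_mult, !(Rabs_pos_eq (ln _)) in E by lra.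
  rewrite <- !abs_IZR in E. rewrite <- !Nat2Z.inj_abs_nat, <- !INR_IZR_INZ in E.
  apply (pow_S_base_neq b (Z.abs_nat k) (Z.abs_nat q) Hb); [lia|].
  apply INR_eq. rewrite !pow_INR.
  apply ln_inv; try (apply pow_lt, (lt_INR 0); lia).
  rewrite !ln_pow by (apply (lt_INR 0); lia). exact E.
Qed.

Lemma Cexp_eq_1 y : Cexp (RtoC y * Ci)%C = RtoC 1 -> exists q, y = 2 * IZR q * PI.
Proof.
  intros E. apply (f_equal Re) in E. unfold Cexp, RtoC, Ci, Cmult, Re, Im in E. simpl in E.
  replace (y * 0 - 0 * 1) with 0 in E by ring. replace (y * 1 + 0 * 0) with (2 * (y / 2)) in E by field.
  rewrite exp_0, cos_2a_sin in E.
  destruct (sin_eq_0_0 (y / 2)) as [q Hq]; [nra|]. exists q. lra.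
Qed.

(** [K] also satisfies the equation for base b + 1, where the factor on the left is 1 - (b +
    1)^(1-s). It is non-zero at s_(0,k), as otherwise k ln(b + 1) would be an integer multiple of ln
    b. With J = 0 no pole enters from the right, and the residue is an empty sum. *)
Lemma full_digits_residue_0 b A K k :
  (1 < b)%nat -> NoDup A -> (forall a, In a A -> (a < b)%nat) -> length A = b ->
  is_meromorphic_continuation b A K -> k <> 0%Z ->
  residue_limit K (candidate_pole b A 0 k) (RtoC 0).
Proof.
  intros Hb HN HA Hlen HK Hk.
  assert (Hb1 : (1 < S b)%nat) by lia.
  pose proof (full_digits_change_base b A (S b) K Hb Hb1 HN Hlen HA HK) as HK'.
  pose proof (ln_INR_pos b Hb) as HL. pose proof (ln_INR_pos (S b) Hb1) as HL1.
  assert (HNs : NoDup (seq 0 (S b))) by apply seq_NoDup.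
  assert (HAs : forall a, In a (seq 0 (S b)) -> (a < S b)%nat) by (intros a Ha; apply in_seq in Ha; lia).
  assert (Hal : abscissa b A = 1).
  { apply (abscissa_bounds b A Hb HN HA); lia. }
  assert (Hal1 : abscissa (S b) (seq 0 (S b)) = 1).
  { apply (abscissa_bounds (S b) (seq 0 (S b)) Hb1 HNs HAs); rewrite length_seq; lia. }
  set (z0 := candidate_pole b A 0 k).
  assert (Hre : Re z0 = 1) by (unfold z0; rewrite Re_candidate_pole, Hal by exact Hb; simpl; lra).
  pose proof (residue_limit_step (S b) (seq 0 (S b)) K 0 z0 (fun _ => RtoC 0) Hb1 HNs HAs HK') as H.
  simpl Csum in H.
  match type of H with _ -> _ -> _ -> residue_limit _ _ ?X => replace X with (RtoC 0) in H by ring end.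
  apply H.
  - rewrite Hal1, Hre. simpl. lra.
  - rewrite length_seq. intros E.
    assert (Ez : z0 = (RtoC 1 + RtoC (IZR k * (2 * PI / ln (INR b))) * Ci)%C).
    { rewrite <- (Im_candidate_pole b A 0 k Hb). fold z0. rewrite <- Hre at 1.
      destruct z0 as [u v]. unfold Ci, RtoC, Cplus, Cmult, Re, Im. simpl. f_equal; ring. }
    set (y := IZR k * (2 * PI / ln (INR b))) in *.
    replace (- z0 * RtoC (ln (INR (S b))))%C with
      (RtoC (- ln (INR (S b))) + RtoC (- y * ln (INR (S b))) * Ci)%C in E.
    2:{ rewrite Ez, RtoC_mult, !RtoC_opp. ring. }
    rewrite Cexp_plus, Cexp_RtoC, exp_Ropp, exp_ln, Cmult_assoc, <- RtoC_mult in E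
      by apply INR_S_pos.
    rewrite Rinv_r in E by apply not_0_INR, Nat.neq_succ_0.
    apply Ceq_minus in E. rewrite Cmult_1_l in E. symmetry in E.
    apply Cexp_eq_1 in E. destruct E as [q Hq]. apply Hk.
    apply (ln_S_base_independent b k (- q) Hb).
    pose proof PI_RGT_0. rewrite opp_IZR.
    apply Rmult_eq_reg_r with (2 * PI / ln (INR b)).
    + transitivity (y * ln (INR (S b))); [unfold y; ring|].
      replace (y * ln (INR (S b))) with (- (2 * IZR q * PI)) by lra. field. lra.
    + apply Rgt_not_eq, Rdiv_lt_0_compat; lra.
  - intros j Hj. lia.
Qed.

Lemma rising_neq_0 s m : (forall i, (0 < i)%nat -> s <> RtoC (INR i)) -> rising s m <> RtoC 0.
Proof.
  intros Hs. induction m as [|m IH]; cbn [rising].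
  - exact C1_nz.
  - apply Cmult_neq_0; [exact IH|]. intros E. apply (Hs (S m)); [lia|].
    symmetry. apply Ceq_minus, E.
Qed.

Theorem mainTheorem5 :
  forall (b : nat) (A : list nat),
    (1 < b)%nat ->
    NoDup A ->
    (forall a : nat, In a A -> (a < b)%nat) ->
    (exists a : nat, In a A /\ a <> 0%nat) ->
  forall K : C -> C,
    is_meromorphic_continuation b A K ->
  forall (m : nat) (k : Z),
    pole K (candidate_pole b A m k) <->
      pole K (candidate_pole b A m 0) /\ pole K (candidate_pole b A 0 k).
Proof.
  intros b A Hb HN HA Hex K HK m k.
  assert (Hlen : (0 < length A)%nat).
  { destruct Hex as [a [Ha _]]. destruct A as [|a1 A']; [destruct Ha|simpl; lia]. }
  assert (HM : meromorphic K) by apply HK.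
  assert (Hres : forall k, exists R0, residue_limit K (candidate_pole b A 0 k) R0).
  { intros k0. apply (residue_limit_exists b A); try assumption.
    - rewrite Re_candidate_pole by exact Hb. simpl. lra.
    - rewrite Cexp_candidate_pole by assumption. rewrite <- RtoC_mult. f_equal. simpl.
      field. apply Rgt_not_eq, (lt_INR 0), Hlen. }
  destruct (Hres 0%Z) as [R00 HR00]. destruct (Hres k) as [R0k HR0k].
  assert (Hs00 : candidate_pole b A 0 0 = RtoC (abscissa b A)).
  { unfold candidate_pole. simpl. ring. }
  assert (HR00ne : R00 <> RtoC 0).
  { apply (residue_at_abscissa_neq_0 b A K); try assumption. rewrite <- Hs00. exact HR00. }
  assert (Hp00 : pole K (candidate_pole b A 0 0)).
  { apply (pole_iff_residue_limit _ _ _ HM HR00), HR00ne. }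
  (* For k = 0, and likewise for m = 0, the equivalence amounts to the presence of the pole at
     s_0. *)
  destruct (Z.eq_dec k 0) as [->|Hk]; [tauto|].
  destruct m as [|m]; [tauto|].
  destruct (residue_ratio_exists b A K Hb HN HA Hlen HK (S m)) as [c Hc].
  pose proof (Hc 0%Z R00 HR00) as Hm0. pose proof (Hc k R0k HR0k) as Hmk.
  rewrite (pole_iff_residue_limit _ _ _ HM HR0k), (pole_iff_residue_limit _ _ _ HM Hm0),
    (pole_iff_residue_limit _ _ _ HM Hmk).
  (* For k <> 0 the point s_(0,k) has non-zero imaginary part, so it is no positive integer. *)
  assert (Hrk : rising (candidate_pole b A 0 k) (S m) <> RtoC 0).
  { apply rising_neq_0. intros i _ E. apply (f_equal Im) in E.
    rewrite Im_candidate_pole in E by exact Hb. change (Im (RtoC (INR i))) with 0 in E.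
    pose proof (ln_INR_pos b Hb). pose proof PI_RGT_0.
    apply Rmult_integral in E. destruct E as [E|E].
    - apply Hk, eq_IZR, E.
    - assert (0 < 2 * PI / ln (INR b)) by (apply Rdiv_lt_0_compat; lra). lra. }
  destruct (abscissa_bounds b A Hb HN HA Hlen) as [Hal [Hal1 _]].
  (* When all digits are allowed the residue at s_(0,k) is 0, hence also the one at s_(m,k), and
     both sides fail. *)
  destruct (Nat.eq_dec (length A) b) as [Hfull|Hnfull].
  - pose proof (full_digits_residue_0 b A K k Hb HN HA Hfull HK Hk) as H0.
    rewrite (plim_unique _ _ _ _ HR0k H0). split.
    + intros H. exfalso. apply H. ring.
    + intros [_ H]. exfalso. apply H. reflexivity.
  (* Now s_0 < 1, so the residue at s_(m,0) is non-zero exactly when [c] is, and the residue at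
     s_(m,k) exactly when both [c] and the residue at s_(0,k) are. *)
  - assert (Hr0 : rising (candidate_pole b A 0 0) (S m) <> RtoC 0).
    { apply rising_neq_0. intros i Hi E. rewrite Hs00 in E. apply RtoC_inj in E.
      apply (le_INR 1) in Hi. simpl in Hi. apply Hnfull, Hal1. lra. }
    split.
    + intros H. split.
      * apply Cmult_neq_0; [apply Cmult_neq_0; [exact Hr0|]|exact HR00ne].
        intros E. apply H. rewrite E. ring.
      * intros E. apply H. rewrite E. ring.
    + intros [H1 H2]. apply Cmult_neq_0; [apply Cmult_neq_0; [exact Hrk|]|exact H2].
      intros E. apply H1. rewrite E. ring.
Qed.
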